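(* Let $c\in(0,3]$ and let $f\in\mathcal{F}^0(c)$. Then for all $z\in\mathbb{D}$, $$\frac{1}{(1+|z|^2)^{c/2}}\leq |f'(z)|\leq\frac{1}{(1-|z|^2)^{c/2}}$$ and $$\int_0^{|z|}\frac{dt}{(1+t^2)^{c/2}}\leq |f(z)|\leq\int_0^{|z|}\frac{dt}{(1-t^2)^{c/2}}.$$ All of these estimates are sharp: for each of the four inequalities and each $z\in\mathbb{D}$, equality holds at $z$ for the function $$f_{c,\lambda}(z)=\int_0^z\frac{d\zeta}{(1-\lambda\zeta^2)^{c/2}}$$ (principal branch) for some $\lambda\in\mathbb{C}$ with $|\lambda|=1$.
   Context: $\mathbb{D}=\{z\in\mathbb{C}:|z|<1\}$. $\mathcal{A}$ is the class of analytic functions $f$ on $\mathbb{D}$ with $f(0)=0$ and $f'(0)=1$. For $c\in(0,3]$, $\mathcal{F}(c)$ is the class of $f\in\mathcal{A}$ (with $f'$ nonvanishing on $\mathbb{D}$) such that $\operatorname{Re}\left(1+\frac{zf''(z)}{f'(z)}\right)>1-\frac{c}{2}$ for all $z\in\mathbb{D}$, and $\mathcal{F}^0(c)=\{f\in\mathcal{F}(c): f''(0)=0\}$. *)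

(* Defs.v *)
From Stdlib Require Import Reals.
From Coquelicot Require Import Coquelicot.
Open Scope R_scope.

Definition in_disk (z : C) : Prop := Cmod z < 1.

(* [f] is a total function on [C], but [ex_derive] and [C_derive] are local, so
   only its values on the open unit disk matter.  The total operator [C_derive]
   (computed by Coquelicot as a limit along the real direction) is the complex
   derivative at every point where [ex_derive] over [C] holds, hence on the whole
   disk for [f] analytic and for [C_derive f]. *)
Definition analytic_on_disk (f : C -> C) : Prop :=
  forall z : C, in_disk z -> ex_derive (K := C_AbsRing) (V := C_NormedModule) f z.

Definition class_A (f : C -> C) : Prop :=
  analytic_on_disk f /\ f (RtoC 0) = RtoC 0 /\ C_derive f (RtoC 0) = RtoC 1.

Definition class_F (c : R) (f : C -> C) : Prop :=
  class_A f /\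
  (forall z : C, in_disk z -> C_derive f z <> RtoC 0) /\
  (forall z : C, in_disk z ->
     Re (1 + z * C_derive (C_derive f) z / C_derive f z)%C > 1 - c / 2).

Definition class_F0 (c : R) (f : C -> C) : Prop :=
  class_F c f /\ C_derive (C_derive f) (RtoC 0) = RtoC 0.

Definition Cexp (w : C) : C := (exp (Re w) * cos (Im w), exp (Re w) * sin (Im w)).

(* Principal argument, in (-PI, PI]; meaningful for [w <> 0] only. *)
Definition Carg (w : C) : R :=
  if Rle_dec 0 (Im w) then acos (Re w / Cmod w) else - acos (Re w / Cmod w).

Definition Clog (w : C) : C := (ln (Cmod w), Carg w).

Definition Cpower (w a : C) : C := Cexp (a * Clog w)%C.

(* Integral of [g] along the straight segment from 0 to [z], parametrized by
   [t |-> t * z] on [[0, 1]]. *)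
Definition segment_int (g : C -> C) (z : C) : C :=
  RInt (V := C_R_CompleteNormedModule) (fun t : R => (g (RtoC t * z) * z)%C) 0 1.

Definition f_ext (c : R) (lambda : C) : C -> C :=
  segment_int
    (fun zeta : C => 1 / Cpower (1 - lambda * (zeta * zeta)) (RtoC (c / 2)))%C.

(* Main.v *)
Require Import Defs.
From Stdlib Require Import Reals Lra Lia Psatz Classical ClassicalEpsilon.
From Coquelicot Require Import Coquelicot.
Open Scope R_scope.

(** With [X = z f'' / f'], the hypothesis and [f''(0) = 0] make [X / (X + c)] a bounded function
    with a double zero, so Schwarz's lemma gives [|X| <= |z|^2 |X + c|], hence sharp bounds for
    [Re X], which is the logarithmic derivative of [|f'|] along a ray.  Integrating along the ray
    gives the distortion bounds and the upper growth bound.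

    For the lower growth bound, [w = 1 - f / (z f')] satisfies [w + z w' = (1 - w) X]; at a point
    where [|w| >= 1] is maximal on a closed disk, Jack's lemma yields [z w' = k w] with [k >= 2],
    forcing [Re X <= - 3 / 2].  Hence [|w| < 1] and [Re (f / (z f')) > 0].  With [F] the claimed
    lower bound, at a minimum [z <> 0] of [|f| - F(|z|) + e |z|] on a closed disk the tangential
    derivative vanishes, so [f / (z f')] is a positive real and [|f|] increases radially at the
    rate [|f'| >= F'(|z|)], which is incompatible with a minimum.

    Differentiability is only assumed pointwise, so [f''] exists through Goursat's theorem and
    Cauchy's formula. *)

(** * Complex derivatives and derivatives of paths *)

(** The condition Re X > - c / 2 says that X is nearer to 0 than to - c, which is why X / (X + c) is
    bounded by 1.

    A lower bound for |f'| on a ray says nothing about |f| there, because f may turn. The classical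
    remedy integrates along the preimage of the segment from 0 to f(z), which requires univalence
    and an inverse function. The minimum argument needs only tangential and radial derivatives of
    |f| at one point; the term e |z| makes the last inequality strict and disappears as e tends to
    0.

    The condition c <= 3 enters through starlikeness: Re X > - c / 2 >= - 3 / 2, while Jack's lemma
    forces Re X <= - (1 + k) / 2. The bound k >= 2 is the order of the zero of w at 0, and this
    order is 2 because f''(0) = 0.

    For sharpness, lambda is chosen with lambda z^2 = - |z|^2 for the lower bounds and lambda z^2 =
    |z|^2 for the upper ones. The integrand of [f_ext] is then a positive multiple of z along the
    whole segment, so nothing is lost in taking moduli. *)

Notation is_Cderive := (@is_derive C_AbsRing C_NormedModule).
Notation is_Pderive := (@is_derive R_AbsRing C_R_NormedModule).

(** Equalities coming out of the general module lemmas are typed at the carrier of a module; [ring]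
    and [field] only recognize them after a conversion to [C]. *)
Ltac ring_C := match goal with |- @eq _ ?a ?b => try change (@eq C a b) end; ring.
Ltac field_C := match goal with |- @eq _ ?a ?b => try change (@eq C a b) end; field.

Lemma is_Cderive_eps (f : C -> C) z l :
  is_Cderive f z l <->
  forall e, 0 < e -> exists d, 0 < d /\ forall y, Cmod (y - z) < d ->
    Cmod (f y - f z - l * (y - z)) <= e * Cmod (y - z).
Proof.
split.
- intros [_ H] e he.
  destruct (H z (fun P HP => HP) (mkposreal e he)) as [d Hd].
  exists d; split; [apply cond_pos|intros y hy]; rewrite (Cmult_comm l); exact (Hd y hy).
- intros H; split; [apply is_linear_scal_l|intros x hx].
  apply (@is_filter_lim_locally_unique C_AbsRing (AbsRing_NormedModule C_AbsRing)) in hx.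
  subst x; intros e; destruct (H e (cond_pos e)) as [d [hd H1]].
  exists (mkposreal d hd); intros y hy; specialize (H1 y hy).
  rewrite (Cmult_comm l) in H1; exact H1.
Qed.

Lemma is_Pderive_eps (f : R -> C) x l :
  is_Pderive f x l <->
  forall e, 0 < e -> exists d, 0 < d /\ forall y, Rabs (y - x) < d ->
    Cmod (f y - f x - l * RtoC (y - x)) <= e * Rabs (y - x).
Proof.
assert (E : forall y, (f y - f x - l * RtoC (y - x))%C
   = minus (minus (f y : C_R_NormedModule) (f x)) (scal (y - x) (l : C_R_NormedModule))).
{ intros y; destruct (f y), (f x), l.
  unfold minus, scal, plus, opp; simpl.
  unfold prod_scal, prod_plus, prod_opp, scal, plus, opp, mult; simpl; unfold mult; simpl.
  unfold Cminus, Cplus, Cmult, Copp; simpl; f_equal; ring. }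
split.
- intros [_ H] e he.
  destruct (H x (fun P HP => HP) (mkposreal e he)) as [d Hd].
  exists d; split; [apply cond_pos|intros y hy]; rewrite E, Cmod_norm; exact (Hd y hy).
- intros H; split; [apply is_linear_scal_l|intros u hu].
  apply (@is_filter_lim_locally_unique R_AbsRing (AbsRing_NormedModule R_AbsRing)) in hu.
  subst u; intros e; destruct (H e (cond_pos e)) as [d [hd H1]].
  exists (mkposreal d hd); intros y hy; specialize (H1 y hy).
  rewrite E, Cmod_norm in H1; exact H1.
Qed.

(** [C] is a normed module over itself in two ways, with the same norm but different uniform
    structures. The general product and chain rules speak of [AbsRing_NormedModule], the definition
    of analyticity of [C_NormedModule]. *)
Lemma is_derive_AbsRing_C (f : C -> C) z l :
  @is_derive C_AbsRing (AbsRing_NormedModule C_AbsRing) f z l <-> is_Cderive f z l.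
Proof. split; intros [[? ? ?] H]; (split; [split; assumption|exact H]). Qed.

Lemma is_Cderive_const (a : C) z : is_Cderive (fun _ => a) z (RtoC 0).
Proof. exact (is_derive_const (K:=C_AbsRing) (V:=C_NormedModule) a z). Qed.

Lemma is_Cderive_id z : is_Cderive (fun w => w) z (RtoC 1).
Proof. apply is_derive_AbsRing_C, (is_derive_id (K:=C_AbsRing) z). Qed.

Lemma is_Cderive_plus f g z (a b : C) :
  is_Cderive f z a -> is_Cderive g z b -> is_Cderive (fun w => f w + g w)%C z (a + b)%C.
Proof. exact (is_derive_plus f g z a b). Qed.

Lemma is_Cderive_minus f g z (a b : C) :
  is_Cderive f z a -> is_Cderive g z b -> is_Cderive (fun w => f w - g w)%C z (a - b)%C.
Proof. exact (is_derive_minus f g z a b). Qed.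

Lemma is_Cderive_mult (f g : C -> C) z a b :
  is_Cderive f z a -> is_Cderive g z b ->
  is_Cderive (fun w => f w * g w)%C z (a * g z + f z * b)%C.
Proof.
intros H1 H2; apply is_derive_AbsRing_C; apply is_derive_AbsRing_C in H1, H2.
exact (is_derive_mult (K:=C_AbsRing) f g z a b H1 H2 Cmult_comm).
Qed.

Lemma is_Cderive_comp (f g : C -> C) z a b :
  is_Cderive f (g z) a -> is_Cderive g z b -> is_Cderive (fun w => f (g w)) z (a * b)%C.
Proof.
intros H1 H2; rewrite Cmult_comm; apply is_derive_AbsRing_C in H2.
exact (is_derive_comp (K:=C_AbsRing) (V:=C_NormedModule) f g z a b H1 H2).
Qed.

Lemma is_Cderive_eq (f : C -> C) z (a b : C) : is_Cderive f z a -> a = b -> is_Cderive f z b.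
Proof. now intros H <-. Qed.

Lemma is_Pderive_eq (f : R -> C) x (a b : C) : is_Pderive f x a -> a = b -> is_Pderive f x b.
Proof. now intros H <-. Qed.

Lemma is_Cderive_ext_loc (f g : C -> C) z l :
  (exists d, 0 < d /\ forall y, Cmod (y - z) < d -> f y = g y) ->
  is_Cderive f z l -> is_Cderive g z l.
Proof.
intros [d [hd H]]; apply (is_derive_ext_loc (K:=C_AbsRing)).
exists (mkposreal d hd); intros y hy; apply H; exact hy.
Qed.

Lemma Cmod_reverse_triangle (a b : C) : Cmod a - Cmod b <= Cmod (a - b).
Proof.
assert (H := Cmod_triangle (a - b) b).
replace (a - b + b)%C with a in H by ring; lra.
Qed.

Lemma Cmod_minus_sym (a b : C) : Cmod (a - b) = Cmod (b - a).
Proof. rewrite <- Cmod_opp; f_equal; ring. Qed.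

Lemma is_Cderive_inv z : z <> RtoC 0 -> is_Cderive Cinv z (- / (z * z))%C.
Proof.
intros hz; apply is_Cderive_eps; intros e he.
assert (hm : 0 < Cmod z) by now apply Cmod_gt_0.
set (m := Cmod z) in *.
assert (hd : 0 < Rmin (m / 2) (e * m ^ 3 / 2)).
{ apply Rmin_glb_lt; [lra|]; assert (0 < m ^ 3) by now apply pow_lt.
  assert (0 < e * m ^ 3) by now apply Rmult_lt_0_compat. lra. }
exists (Rmin (m / 2) (e * m ^ 3 / 2)); split; [assumption|]; intros y hy.
assert (h1 := Rlt_le_trans _ _ _ hy (Rmin_l _ _)).
assert (h2 := Rlt_le_trans _ _ _ hy (Rmin_r _ _)).
assert (hmy : m / 2 < Cmod y).
{ assert (H := Cmod_reverse_triangle z (z - y)).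
  replace (z - (z - y))%C with y in H by ring.
  rewrite (Cmod_minus_sym z y) in H; fold m in H; lra. }
assert (hy0 : y <> RtoC 0) by (apply Cmod_gt_0; lra).
(* The remainder is exactly quadratic in [y - z], and [y] stays away from 0 because |y| > |z| /
   2. *)
replace (/ y - / z - - / (z * z) * (y - z))%C with ((y - z) * (y - z) / (z * z * y))%C
  by (field; auto).
rewrite Cmod_div, !Cmod_mult by (repeat apply Cmult_neq_0; auto); fold m.
set (h := Cmod (y - z)) in *.
assert (hh : 0 <= h) by apply Cmod_ge_0.
assert (hp : 0 < m * m * Cmod y) by (repeat apply Rmult_lt_0_compat; lra).
apply Rmult_le_reg_r with (m * m * Cmod y); [assumption|].
unfold Rdiv; rewrite Rmult_assoc, Rinv_l, Rmult_1_r by lra.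
assert (h <= e * (m * m * Cmod y)).
{ apply Rle_trans with (e * (m * m * (m / 2))); [lra|].
  apply Rmult_le_compat_l; [lra|]; apply Rmult_le_compat_l; [nra|lra]. }
nra.
Qed.

Lemma is_Cderive_div (f g : C -> C) z a b :
  g z <> RtoC 0 -> is_Cderive f z a -> is_Cderive g z b ->
  is_Cderive (fun w => f w / g w)%C z ((a * g z - f z * b) / (g z * g z))%C.
Proof.
intros hg Hf Hg.
assert (Hi := is_Cderive_comp Cinv g z _ _ (is_Cderive_inv _ hg) Hg).
refine (is_Cderive_eq _ _ _ _ (is_Cderive_mult f (fun w => / g w)%C z _ _ Hf Hi) _).
field; auto.
Qed.

Lemma is_Cderive_continuous (f : C -> C) z l :
  is_Cderive f z l ->
  forall e, 0 < e -> exists d, 0 < d /\ forall y, Cmod (y - z) < d -> Cmod (f y - f z) < e.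
Proof.
intros H e he; destruct (proj1 (is_Cderive_eps f z l) H 1 Rlt_0_1) as [d [hd Hd]].
set (K := 1 + Cmod l); assert (hK : 0 < K) by (generalize (Cmod_ge_0 l); unfold K; lra).
exists (Rmin d (e / K)); split.
- apply Rmin_glb_lt; [lra|now apply Rdiv_lt_0_compat].
- intros y hy.
  assert (h1 := Rlt_le_trans _ _ _ hy (Rmin_l _ _)).
  assert (h2 := Rlt_le_trans _ _ _ hy (Rmin_r _ _)).
  assert (H1 := Cmod_triangle (f y - f z - l * (y - z)) (l * (y - z))).
  replace (f y - f z - l * (y - z) + l * (y - z))%C with (f y - f z)%C in H1 by ring.
  rewrite Cmod_mult in H1; specialize (Hd y h1).
  assert (Cmod (y - z) * K < e).
  { apply Rmult_lt_reg_r with (/ K); [now apply Rinv_0_lt_compat|].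
    rewrite Rmult_assoc, Rinv_r by lra; unfold Rdiv in h2; lra. }
  unfold K in *; lra.
Qed.

(** Balls of [C_UniformSpace] are squares, being those of a product; a square of radius [e / 2] lies
    in the disk of radius [e] because sqrt 2 <= 2. *)
Lemma continuous_C_eps {U : UniformSpace} (f : U -> C) x :
  continuous (f : U -> C_UniformSpace) x <->
  forall e, 0 < e -> locally x (fun y => Cmod (f y - f x) < e).
Proof.
split.
- intros H e he.
  assert (h : 0 < e / 2) by lra.
  specialize (H (fun w => Cmod (w - f x) < e)); apply H.
  exists (mkposreal _ h); intros w hw.
  apply Rlt_le_trans with (sqrt 2 * (e / 2)).
  + exact (C_NormedModule_mixin_compat2 (f x) w (mkposreal _ h) hw).
  + assert (sqrt 2 <= 2).
    { rewrite <- (sqrt_square 2) at 2 by lra; apply sqrt_le_1; lra. }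
    nra.
- intros H P [e He].
  change (locally x (fun y => P (f y))).
  generalize (H e (cond_pos e)); apply filter_imp; intros y hy; apply He.
  exact (C_NormedModule_mixin_compat1 (f x) (f y) e hy).
Qed.

Lemma continuous_Cmult {U : UniformSpace} (f g : U -> C) x :
  continuous (f : U -> C_UniformSpace) x -> continuous (g : U -> C_UniformSpace) x ->
  continuous ((fun y => f y * g y)%C : U -> C_UniformSpace) x.
Proof.
rewrite !continuous_C_eps; intros Hf Hg e he.
set (K := 1 + Cmod (f x) + Cmod (g x)).
assert (hf := Cmod_ge_0 (f x)); assert (hg := Cmod_ge_0 (g x)).
set (d := Rmin 1 (e / K)).
assert (hK : 0 < K) by (unfold K; lra).
assert (hd : 0 < d) by (apply Rmin_glb_lt; [lra|now apply Rdiv_lt_0_compat]).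
generalize (filter_and _ _ (Hf d hd) (Hg d hd)); apply filter_imp; intros y [h1 h2].
replace (f y * g y - f x * g x)%C
  with ((f y - f x) * (g y - g x) + (f y - f x) * g x + f x * (g y - g x))%C by ring.
assert (H1 := Cmod_triangle ((f y - f x) * (g y - g x) + (f y - f x) * g x) (f x * (g y - g x))).
assert (H2 := Cmod_triangle ((f y - f x) * (g y - g x)) ((f y - f x) * g x)).
rewrite !Cmod_mult in *.
assert (p1 := Cmod_ge_0 (f y - f x)); assert (p2 := Cmod_ge_0 (g y - g x)).
assert (d1 : d <= 1) by apply Rmin_l.
assert (d2 : d * K <= e).
{ apply Rle_trans with (e / K * K); [|right; field; lra].
  apply Rmult_le_compat_r; [lra|apply Rmin_r]. }
assert (Cmod (f y - f x) * Cmod (g y - g x) < d) by nra.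
unfold K in *; nra.
Qed.

Lemma continuous_Cplus {U : UniformSpace} (f g : U -> C) x :
  continuous (f : U -> C_UniformSpace) x -> continuous (g : U -> C_UniformSpace) x ->
  continuous ((fun y => f y + g y)%C : U -> C_UniformSpace) x.
Proof. exact (continuous_plus (V:=C_R_NormedModule) f g x). Qed.

Lemma continuous_Cminus {U : UniformSpace} (f g : U -> C) x :
  continuous (f : U -> C_UniformSpace) x -> continuous (g : U -> C_UniformSpace) x ->
  continuous ((fun y => f y - g y)%C : U -> C_UniformSpace) x.
Proof. exact (continuous_minus (V:=C_R_NormedModule) f g x). Qed.

Lemma continuous_C_comp {U : UniformSpace} (F : C -> C) (g : U -> C) x l :
  is_Cderive F (g x) l -> continuous (g : U -> C_UniformSpace) x ->
  continuous ((fun y => F (g y)) : U -> C_UniformSpace) x.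
Proof.
intros HF Hg; rewrite continuous_C_eps in *; intros e he.
destruct (is_Cderive_continuous F (g x) l HF e he) as [d [hd H]].
generalize (Hg d hd); apply filter_imp; intros y hy; now apply H.
Qed.

Lemma continuous_RtoC (x : R) : continuous (RtoC : R -> C_UniformSpace) x.
Proof.
apply continuous_C_eps; intros e he; exists (mkposreal e he); intros y hy.
rewrite <- RtoC_minus, Cmod_R; exact hy.
Qed.

Lemma is_Pderive_continuous (g : R -> C) x l :
  is_Pderive g x l -> continuous (g : R -> C_UniformSpace) x.
Proof. intros H; apply (ex_derive_continuous (V:=C_R_NormedModule)); now exists l. Qed.

Lemma is_Pderive_comp (F : C -> C) (g : R -> C) x a b :
  is_Cderive F (g x) a -> is_Pderive g x b -> is_Pderive (fun s => F (g s)) x (a * b)%C.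
Proof.
intros HF Hg; apply is_Pderive_eps; intros e he.
assert (Hc := is_Pderive_continuous g x b Hg).
rewrite continuous_C_eps in Hc; rewrite is_Cderive_eps in HF; rewrite is_Pderive_eps in Hg.
set (K := 2 + Cmod a + Cmod b).
assert (ha := Cmod_ge_0 a); assert (hb := Cmod_ge_0 b).
set (e1 := Rmin 1 (e / K)).
assert (hK : 0 < K) by (unfold K; lra).
assert (he1 : 0 < e1) by (apply Rmin_glb_lt; [lra|now apply Rdiv_lt_0_compat]).
assert (d1 : e1 <= 1) by apply Rmin_l.
assert (d2 : e1 * K <= e).
{ apply Rle_trans with (e / K * K); [|right; field; lra].
  apply Rmult_le_compat_r; [lra|apply Rmin_r]. }
destruct (HF e1 he1) as [d3 [hd3 H3]]; destruct (Hg e1 he1) as [d4 [hd4 H4]].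
destruct (Hc d3 hd3) as [d5 H5].
exists (Rmin d4 d5); split; [apply Rmin_glb_lt; [lra|apply cond_pos]|]; intros y hy.
assert (h4 := H4 y (Rlt_le_trans _ _ _ hy (Rmin_l _ _))).
assert (h3 := H3 (g y) (H5 y (Rlt_le_trans _ _ _ hy (Rmin_r _ _)))).
set (h := Rabs (y - x)) in *; assert (hh : 0 <= h) by apply Rabs_pos.
assert (hg : Cmod (g y - g x) <= (1 + Cmod b) * h).
{ assert (T := Cmod_triangle (g y - g x - b * RtoC (y - x)) (b * RtoC (y - x))).
  replace (g y - g x - b * RtoC (y - x) + b * RtoC (y - x))%C with (g y - g x)%C in T by ring.
  rewrite Cmod_mult, Cmod_R in T; fold h in T; nra. }
replace (F (g y) - F (g x) - a * b * RtoC (y - x))%C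
  with ((F (g y) - F (g x) - a * (g y - g x)) + a * (g y - g x - b * RtoC (y - x)))%C by ring.
eapply Rle_trans; [apply Cmod_triangle|]; rewrite Cmod_mult.
apply Rle_trans with (e1 * ((1 + Cmod b) * h) + Cmod a * (e1 * h)).
- apply Rplus_le_compat.
  + apply Rle_trans with (1 := h3), Rmult_le_compat_l; lra.
  + now apply Rmult_le_compat_l.
- replace (e1 * ((1 + Cmod b) * h) + Cmod a * (e1 * h)) with (e1 * (1 + Cmod b + Cmod a) * h) by ring.
  apply Rmult_le_compat_r; [assumption|]; unfold K in *; nra.
Qed.

Lemma is_Pderive_Re (g : R -> C) x l :
  is_Pderive g x l -> is_derive (fun s => Re (g s)) x (Re l).
Proof.
intros H; split; [apply is_linear_scal_l|intros u hu].
apply (@is_filter_lim_locally_unique R_AbsRing (AbsRing_NormedModule R_AbsRing)) in hu; subst u; intros e.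
destruct (proj1 (is_Pderive_eps g x l) H e (cond_pos e)) as [d [hd Hd]].
exists (mkposreal d hd); intros y hy.
apply Rle_trans with (2 := Hd y hy).
apply Rle_trans with (2 := re_le_Cmod _); right; destruct (g y), (g x), l.
unfold norm, minus, plus, opp, scal; simpl; unfold abs, mult; simpl; f_equal; ring.
Qed.

Lemma is_Pderive_pair (u v : R -> R) x a b :
  is_derive u x a -> is_derive v x b -> is_Pderive (fun s => (u s, v s)) x (a, b).
Proof.
assert (E : forall (w : R -> R) c, is_derive w x c -> forall e, 0 < e ->
  exists d, 0 < d /\ forall y, Rabs (y - x) < d ->
    Rabs (w y - w x - c * (y - x)) <= e * Rabs (y - x)).
{ intros w c [_ H] e he; destruct (H x (fun P HP => HP) (mkposreal e he)) as [d Hd].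
  exists d; split; [apply cond_pos|intros y hy]; rewrite (Rmult_comm c); exact (Hd y hy). }
intros Hu Hv; apply is_Pderive_eps; intros e he.
assert (h : 0 < e / 2) by lra.
destruct (E u a Hu _ h) as [d1 [h1 H1]]; destruct (E v b Hv _ h) as [d2 [h2 H2]].
exists (Rmin d1 d2); split; [now apply Rmin_glb_lt|intros y hy].
specialize (H1 y (Rlt_le_trans _ _ _ hy (Rmin_l _ _))).
specialize (H2 y (Rlt_le_trans _ _ _ hy (Rmin_r _ _))).
assert (D : forall p q, Cmod (p, q) <= Rabs p + Rabs q).
{ intros p q; replace ((p, q) : C) with (RtoC p + Ci * RtoC q)%C
    by (unfold Ci, RtoC, Cplus, Cmult; simpl; f_equal; ring).
  eapply Rle_trans; [apply Cmod_triangle|]; rewrite Cmod_mult, Cmod_Ci, !Cmod_R; lra. }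
replace ((u y, v y) - (u x, v x) - (a, b) * RtoC (y - x))%C
  with ((u y - u x - a * (y - x), v y - v x - b * (y - x)) : C)
  by (unfold RtoC, Cminus, Cplus, Copp, Cmult; simpl; f_equal; ring).
eapply Rle_trans; [apply D|]; lra.
Qed.

Lemma is_Pderive_RtoC (u : R -> R) x a :
  is_derive u x a -> is_Pderive (fun s => RtoC (u s)) x (RtoC a).
Proof. intros H; exact (is_Pderive_pair u (fun _ => 0) x a 0 H (is_derive_const 0 x)). Qed.

Lemma is_Pderive_plus (f g : R -> C) x (a b : C) :
  is_Pderive f x a -> is_Pderive g x b -> is_Pderive (fun s => f s + g s)%C x (a + b)%C.
Proof. exact (is_derive_plus f g x a b). Qed.

Lemma is_Pderive_minus (f g : R -> C) x (a b : C) :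
  is_Pderive f x a -> is_Pderive g x b -> is_Pderive (fun s => f s - g s)%C x (a - b)%C.
Proof. exact (is_derive_minus f g x a b). Qed.

Lemma is_Pderive_const (a : C) x : is_Pderive (fun _ => a) x (RtoC 0).
Proof. exact (is_derive_const (V:=C_R_NormedModule) a x). Qed.

Lemma is_Cderive_affine (a b z : C) : is_Cderive (fun w => a + b * w)%C z b.
Proof.
refine (is_Cderive_eq _ _ _ _ (is_Cderive_plus _ _ z _ _ (is_Cderive_const a z)
  (is_Cderive_mult _ _ z _ _ (is_Cderive_const b z) (is_Cderive_id z))) _); ring.
Qed.

Lemma is_Pderive_affine (a b : C) x : is_Pderive (fun s => a + b * RtoC s)%C x b.
Proof.
refine (is_Pderive_eq _ _ _ _ (is_Pderive_comp _ RtoC x _ _ (is_Cderive_affine a b _)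
  (is_Pderive_RtoC (fun s => s) x 1 (is_derive_id x))) _); ring.
Qed.

(** Differentiation directed by the syntax of the function. Only the nonvanishing of denominators is
    left; [Cderive] also leaves the comparison of the computed derivative with the expected one. *)
Ltac Cderive_rec :=
  lazymatch goal with
  | |- is_Cderive (fun _ => ?c) _ _ => exact (is_Cderive_const c _)
  | |- is_Cderive (fun w => w) _ _ => exact (is_Cderive_id _)
  | |- is_Cderive (fun w => Cplus (@?f w) (@?g w)) _ _ =>
      refine (is_Cderive_plus f g _ _ _ _ _); Cderive_rec
  | |- is_Cderive (fun w => Cminus (@?f w) (@?g w)) _ _ =>
      refine (is_Cderive_minus f g _ _ _ _ _); Cderive_rec
  | |- is_Cderive (fun w => Cmult (@?f w) (@?g w)) _ _ =>
      refine (is_Cderive_mult f g _ _ _ _ _); Cderive_rec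
  | |- is_Cderive (fun w => Cdiv (@?f w) (@?g w)) _ _ =>
      refine (is_Cderive_div f g _ _ _ _ _ _); [ | Cderive_rec | Cderive_rec]
  | |- is_Cderive (fun w => ?f w) ?z ?l => change (is_Cderive f z l); eassumption
  | |- _ => eassumption
  end.

Ltac Cderive := refine (is_Cderive_eq _ _ _ _ _ _); [Cderive_rec|]; cbv beta.
Ltac ex_Cderive := eexists; Cderive_rec; cbv beta.

(** * Integrals of complex-valued functions and Goursat's theorem *)

Notation RIntC := (@RInt C_R_CompleteNormedModule).
Notation ex_RIntC := (@ex_RInt C_R_NormedModule).
Notation is_RIntC := (@is_RInt C_R_NormedModule).

Lemma ex_RIntC_continuous (f : R -> C) a b :
  a <= b -> (forall s, a <= s <= b -> continuous (f : R -> C_UniformSpace) s) -> ex_RIntC f a b.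
Proof.
intros hab H; apply (ex_RInt_continuous (V:=C_R_CompleteNormedModule)).
intros s; rewrite Rmin_left, Rmax_right by assumption; apply H.
Qed.

Lemma Cmod_RIntC_le (f : R -> C) a b M :
  a <= b -> ex_RIntC f a b -> (forall s, a <= s <= b -> Cmod (f s) <= M) ->
  Cmod (RIntC f a b) <= (b - a) * M.
Proof.
intros hab Hf HM; rewrite Cmod_norm.
apply (norm_RInt_le_const (V:=C_R_NormedModule) f a b); [assumption| |].
- intros s hs; rewrite <- Cmod_norm; now apply HM.
- now apply (RInt_correct (V:=C_R_CompleteNormedModule)).
Qed.

Lemma RIntC_plus (f g : R -> C) a b :
  ex_RIntC f a b -> ex_RIntC g a b ->
  RIntC (fun s => f s + g s)%C a b = (RIntC f a b + RIntC g a b)%C.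
Proof. exact (RInt_plus (V:=C_R_CompleteNormedModule) f g a b). Qed.

Lemma RIntC_minus (f g : R -> C) a b :
  ex_RIntC f a b -> ex_RIntC g a b ->
  RIntC (fun s => f s - g s)%C a b = (RIntC f a b - RIntC g a b)%C.
Proof. exact (RInt_minus (V:=C_R_CompleteNormedModule) f g a b). Qed.

Lemma RIntC_Chasles (f : R -> C) a b c :
  ex_RIntC f a b -> ex_RIntC f b c -> RIntC f a c = (RIntC f a b + RIntC f b c)%C.
Proof. intros H1 H2; symmetry; exact (RInt_Chasles (V:=C_R_CompleteNormedModule) f a b c H1 H2). Qed.

Lemma RIntC_ext (f g : R -> C) a b :
  a <= b -> (forall s, a <= s <= b -> f s = g s) -> RIntC f a b = RIntC g a b.
Proof.
intros hab H; apply (RInt_ext (V:=C_R_CompleteNormedModule)).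
intros s; rewrite Rmin_left, Rmax_right by assumption; intros hs; apply H; lra.
Qed.

Lemma is_RIntC_scal (k : C) (f : R -> C) a b l :
  is_RIntC f a b l -> is_RIntC (fun s => k * f s)%C a b (k * l)%C.
Proof.
intros H.
assert (H1 := is_RInt_fct_extend_fst (U:=R_NormedModule) (V:=R_NormedModule) f a b l H).
assert (H2 := is_RInt_fct_extend_snd (U:=R_NormedModule) (V:=R_NormedModule) f a b l H).
apply (is_RInt_fct_extend_pair (U:=R_NormedModule) (V:=R_NormedModule)); simpl.
- exact (is_RInt_minus (V:=R_NormedModule) _ _ a b _ _
    (is_RInt_scal _ a b (fst k) _ H1) (is_RInt_scal _ a b (snd k) _ H2)).
- exact (is_RInt_plus (V:=R_NormedModule) _ _ a b _ _
    (is_RInt_scal _ a b (fst k) _ H2) (is_RInt_scal _ a b (snd k) _ H1)).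
Qed.

Lemma RIntC_scal (k : C) (f : R -> C) a b :
  ex_RIntC f a b -> RIntC (fun s => k * f s)%C a b = (k * RIntC f a b)%C.
Proof.
intros H; apply (is_RInt_unique (V:=C_R_CompleteNormedModule)), is_RIntC_scal.
now apply (RInt_correct (V:=C_R_CompleteNormedModule)).
Qed.

Lemma RIntC_const (k : C) a b : RIntC (fun _ => k) a b = (RtoC (b - a) * k)%C.
Proof.
rewrite (RInt_const (V:=C_R_CompleteNormedModule)); destruct k.
unfold scal; simpl; unfold prod_scal, scal; simpl; unfold mult; simpl.
unfold RtoC, Cmult; simpl; f_equal; ring.
Qed.

Lemma RIntC_derive (g dg : R -> C) a b :
  a <= b -> (forall s, a <= s <= b -> is_Pderive g s (dg s)) ->
  (forall s, a <= s <= b -> continuous (dg : R -> C_UniformSpace) s) ->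
  RIntC dg a b = (g b - g a)%C.
Proof.
intros hab H1 H2; apply (is_RInt_unique (V:=C_R_CompleteNormedModule)).
apply (is_RInt_derive (V:=C_R_CompleteNormedModule) g dg a b);
  intros s; rewrite Rmin_left, Rmax_right by assumption; auto.
Qed.

(** * Goursat's theorem for images of rectangles *)

Lemma half_pow_lt (L d : R) : 0 <= L -> 0 < d -> exists n, L / 2 ^ n < d.
Proof.
intros hL hd; destruct (Pow_x_infinity 2) with (b := (L + 1) / d) as [N HN].
- rewrite Rabs_right; lra.
- exists N; specialize (HN N (le_n N)).
  assert (h : 0 < 2 ^ N) by (apply pow_lt; lra).
  rewrite Rabs_right in HN by lra.
  apply Rmult_lt_reg_r with (2 ^ N); [assumption|].
  replace (L / 2 ^ N * 2 ^ N) with L by (field; lra).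
  apply Rge_le in HN; apply Rmult_le_compat_r with (r := d) in HN; [|lra].
  replace ((L + 1) / d * d) with (L + 1) in HN by (field; lra); lra.
Qed.

(* Goursat's bisection: the local hypothesis scales like the area of the four quarters. *)
Lemma bisection_rectangle (Phi : R -> R -> R -> R -> R) s1 s2 t1 t2 :
  s1 <= s2 -> t1 <= t2 ->
  (forall a b c d, s1 <= a -> a <= b -> b <= s2 -> t1 <= c -> c <= d -> d <= t2 ->
     Phi a b c d <= Phi a ((a + b) / 2) c ((c + d) / 2) + Phi a ((a + b) / 2) ((c + d) / 2) d
        + Phi ((a + b) / 2) b c ((c + d) / 2) + Phi ((a + b) / 2) b ((c + d) / 2) d) ->
  (forall p q, s1 <= p <= s2 -> t1 <= q <= t2 -> forall e, 0 < e -> exists r, 0 < r /\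
     forall a b c d, s1 <= a -> a <= p <= b -> b <= s2 -> t1 <= c -> c <= q <= d -> d <= t2 ->
       (b - a) + (d - c) < r -> Phi a b c d <= e * ((b - a) + (d - c)) ^ 2) ->
  Phi s1 s2 t1 t2 <= 0.
Proof.
intros hs ht Hsub Hloc; apply Rnot_lt_le; intros Hpos.
set (L := (s2 - s1) + (t2 - t1)).
assert (hL : 0 <= L) by (unfold L; lra).
(* This makes [e * L ^ 2] smaller than [Phi] on the whole rectangle; the [+ 1] covers a rectangle
   reduced to a point. *)
set (e := Phi s1 s2 t1 t2 / (L ^ 2 + 1)).
assert (hL2 : 0 <= L ^ 2) by now apply pow_le.
assert (he : 0 < e) by (apply Rdiv_lt_0_compat; lra).
set (inv := fun Q : (R * R) * (R * R) => let '((a, b), (c, d)) := Q in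
  s1 <= a /\ a <= b /\ b <= s2 /\ t1 <= c /\ c <= d /\ d <= t2 /\
  e * ((b - a) + (d - c)) ^ 2 < Phi a b c d).
set (quarter := fun Q Q' : (R * R) * (R * R) =>
  let '((a, b), (c, d)) := Q in let '((a', b'), (c', d')) := Q' in
  a <= a' /\ b' <= b /\ c <= c' /\ d' <= d /\
  (b' - a') + (d' - c') = ((b - a) + (d - c)) / 2).
assert (step : forall Q, inv Q -> exists Q', inv Q' /\ quarter Q Q').
{ intros [[a b] [c d]] (h1 & h2 & h3 & h4 & h5 & h6 & h7).
  specialize (Hsub a b c d h1 h2 h3 h4 h5 h6).
  set (m := (a + b) / 2) in *; set (n := (c + d) / 2) in *.
  set (l := (b - a) + (d - c)) in *.
  (* If all four quarters were below a quarter of [e * l ^ 2], subadditivity would contradict the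
     invariant, so some quarter inherits it. *)
  assert (E : e * l ^ 2 = 4 * (e * (l / 2) ^ 2)) by field.
  destruct (Rlt_le_dec (e * (l / 2) ^ 2) (Phi a m c n)) as [k1|k1];
  [exists ((a, m), (c, n))|
  destruct (Rlt_le_dec (e * (l / 2) ^ 2) (Phi a m n d)) as [k2|k2];
  [exists ((a, m), (n, d))|
  destruct (Rlt_le_dec (e * (l / 2) ^ 2) (Phi m b c n)) as [k3|k3];
  [exists ((m, b), (c, n))|
  destruct (Rlt_le_dec (e * (l / 2) ^ 2) (Phi m b n d)) as [k4|k4];
  [exists ((m, b), (n, d))|exfalso; lra]]]];
  unfold inv, quarter;
  match goal with k : e * (l / 2) ^ 2 < _ |- context [e * ?u ^ 2] =>
    replace u with (l / 2) by (unfold l, m, n; field) end;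
  repeat split; try assumption; unfold l, m, n; lra. }
set (next := fun Q : sig inv =>
  let H := constructive_indefinite_description _ (step (proj1_sig Q) (proj2_sig Q)) in
  exist inv (proj1_sig H) (proj1 (proj2_sig H))).
assert (i0 : inv ((s1, s2), (t1, t2))).
{ unfold inv; fold L; repeat split; try lra.
  apply Rmult_lt_reg_r with (L ^ 2 + 1); [lra|].
  unfold e; replace (Phi s1 s2 t1 t2 / (L ^ 2 + 1) * L ^ 2 * (L ^ 2 + 1))
    with (Phi s1 s2 t1 t2 * L ^ 2) by (field; lra); lra. }
set (Q := fix Q n := match n with O => exist inv _ i0 | S k => next (Q k) end).
set (A := fun n => fst (fst (proj1_sig (Q n)))); set (B := fun n => snd (fst (proj1_sig (Q n)))).
set (C' := fun n => fst (snd (proj1_sig (Q n)))); set (D := fun n => snd (snd (proj1_sig (Q n)))).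
assert (HI : forall n, s1 <= A n /\ A n <= B n /\ B n <= s2 /\ t1 <= C' n /\ C' n <= D n /\
  D n <= t2 /\ e * ((B n - A n) + (D n - C' n)) ^ 2 < Phi (A n) (B n) (C' n) (D n)).
{ intros n; generalize (proj2_sig (Q n)); unfold A, B, C', D.
  destruct (proj1_sig (Q n)) as [[a b] [c d]]; exact (fun H => H). }
assert (HQ : forall n, A n <= A (S n) /\ B (S n) <= B n /\ C' n <= C' (S n) /\ D (S n) <= D n /\
  (B (S n) - A (S n)) + (D (S n) - C' (S n)) = ((B n - A n) + (D n - C' n)) / 2).
{ intros n.
  assert (H : quarter (proj1_sig (Q n)) (proj1_sig (Q (S n)))).
  { simpl; exact (proj2 (proj2_sig (constructive_indefinite_description _
      (step (proj1_sig (Q n)) (proj2_sig (Q n)))))). }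
  unfold A, B, C', D; revert H.
  destruct (proj1_sig (Q n)) as [[a b] [c d]], (proj1_sig (Q (S n))) as [[a' b'] [c' d']].
  exact (fun H => H). }
assert (Hsize : forall n, (B n - A n) + (D n - C' n) = L / 2 ^ n).
{ induction n as [|n IH]; [unfold A, B, C', D, L; simpl; field|].
  destruct (HQ n) as (_ & _ & _ & _ & ->); rewrite IH; simpl; field; apply pow_nonzero; lra. }
assert (nested : forall U V : nat -> R, (forall n, U n <= V n) -> (forall n, U n <= U (S n)) ->
  (forall n, V (S n) <= V n) -> exists p, forall n, U n <= p <= V n).
{ intros U V h1 h2 h3.
  assert (UV : forall m n, U m <= V n).
  { assert (mU : forall m k, U m <= U (m + k)%nat).
    { intros m k; induction k as [|k IH]; [rewrite Nat.add_0_r; lra|].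
      rewrite Nat.add_succ_r; generalize (h2 (m + k)%nat); lra. }
    assert (mV : forall m k, V (m + k)%nat <= V m).
    { intros m k; induction k as [|k IH]; [rewrite Nat.add_0_r; lra|].
      rewrite Nat.add_succ_r; generalize (h3 (m + k)%nat); lra. }
    intros m n; generalize (mU m n) (mV n m) (h1 (m + n)%nat).
    rewrite (Nat.add_comm n m); lra. }
  destruct (completeness (fun x => exists n, x = U n)) as [p [hp1 hp2]].
  - exists (V O); intros x [n ->]; apply UV.
  - exists (U O); now exists O.
  - exists p; intros n; split; [apply hp1; now exists n|].
    apply hp2; intros x [m ->]; apply UV. }
destruct (nested A B) as [p Hp]; try (intros n; apply HI); try (intros n; apply HQ).
destruct (nested C' D) as [q Hq]; try (intros n; apply HI); try (intros n; apply HQ).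
assert (hp : s1 <= p <= s2) by (generalize (Hp O) (HI O); lra).
assert (hq : t1 <= q <= t2) by (generalize (Hq O) (HI O); lra).
destruct (Hloc p q hp hq e he) as [r [hr Hr]].
destruct (half_pow_lt L r hL hr) as [n hn].
specialize (Hr (A n) (B n) (C' n) (D n)); destruct (HI n) as (? & ? & ? & ? & ? & ? & ?).
assert (Phi (A n) (B n) (C' n) (D n) <= e * (B n - A n + (D n - C' n)) ^ 2); [|lra].
apply Hr; auto; rewrite Hsize; assumption.
Qed.

(** A function close to one that has a primitive has nearly the integral of that one; in Goursat's
    argument [q] is the tangent map of [F] at a point. *)
Lemma path_integral_approx (F q Q : C -> C) (g dg : R -> C) a b M :
  a <= b ->
  (forall s, a <= s <= b -> is_Pderive g s (dg s)) ->
  (forall s, a <= s <= b -> continuous (dg : R -> C_UniformSpace) s) ->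
  (forall s, a <= s <= b -> exists l, is_Cderive F (g s) l) ->
  (forall z, is_Cderive Q z (q z)) -> (forall z, exists l, is_Cderive q z l) ->
  (forall s, a <= s <= b -> Cmod (F (g s) - q (g s)) * Cmod (dg s) <= M) ->
  ex_RIntC (fun s => F (g s) * dg s)%C a b /\
  Cmod (RIntC (fun s => F (g s) * dg s)%C a b - (Q (g b) - Q (g a))) <= (b - a) * M.
Proof.
intros hab Hg Hdg HF HQ Hq HM.
assert (cg : forall s, a <= s <= b -> continuous (g : R -> C_UniformSpace) s).
{ intros s hs; apply (is_Pderive_continuous _ _ _ (Hg s hs)). }
assert (c1 : forall s, a <= s <= b ->
  continuous ((fun s => F (g s) * dg s)%C : R -> C_UniformSpace) s).
{ intros s hs; apply continuous_Cmult; [|now apply Hdg].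
  destruct (HF s hs) as [l Hl]; now apply (continuous_C_comp F g s l); auto. }
assert (c2 : forall s, a <= s <= b ->
  continuous ((fun s => q (g s) * dg s)%C : R -> C_UniformSpace) s).
{ intros s hs; apply continuous_Cmult; [|now apply Hdg].
  destruct (Hq (g s)) as [l Hl]; now apply (continuous_C_comp q g s l); auto. }
assert (i1 := ex_RIntC_continuous _ a b hab c1); assert (i2 := ex_RIntC_continuous _ a b hab c2).
split; [assumption|].
rewrite <- (RIntC_derive (fun s => Q (g s)) (fun s => q (g s) * dg s)%C a b); auto.
- rewrite <- RIntC_minus by assumption.
  apply Cmod_RIntC_le; [assumption| |].
  + apply ex_RIntC_continuous; [assumption|]; intros s hs; apply continuous_Cminus; auto.
  + intros s hs.
    replace (F (g s) * dg s - q (g s) * dg s)%C with ((F (g s) - q (g s)) * dg s)%C by ring.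
    rewrite Cmod_mult; auto.
- intros s hs; apply is_Pderive_comp; auto.
Qed.

Lemma Cmod_continuous_bounded (g : R -> C) a b :
  (forall s, a <= s <= b -> continuous (g : R -> C_UniformSpace) s) ->
  exists M, 0 < M /\ forall s, a <= s <= b -> Cmod (g s) <= M.
Proof.
intros H; destruct (bounded_continuity (V:=C_R_NormedModule) g a b H) as [M HM].
exists (Rmax M 1); split; [apply Rlt_le_trans with (2 := Rmax_r _ _); lra|].
intros s hs; apply Rle_trans with (2 := Rmax_l _ _); rewrite Cmod_norm; left; now apply HM.
Qed.

(* The map [(s, t) |-> z0 + t * g s] need not be injective, so that this also serves as a homotopy
   from the curve [z0 + g] to small curves around [z0]. *)
Lemma Goursat_cone (F : C -> C) (z0 : C) (g dg : R -> C) s1 s2 t1 t2 :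
  s1 <= s2 -> t1 <= t2 ->
  (forall s, is_Pderive g s (dg s)) ->
  (forall s, continuous (dg : R -> C_UniformSpace) s) ->
  (forall s t, s1 <= s <= s2 -> t1 <= t <= t2 ->
     exists l, is_Cderive F (z0 + RtoC t * g s)%C l) ->
  (RIntC (fun s => F (z0 + RtoC t2 * g s) * (RtoC t2 * dg s)) s1 s2
     - RIntC (fun s => F (z0 + RtoC t1 * g s) * (RtoC t1 * dg s)) s1 s2
   = RIntC (fun t => F (z0 + RtoC t * g s2) * g s2) t1 t2
     - RIntC (fun t => F (z0 + RtoC t * g s1) * g s1) t1 t2)%C.
Proof.
intros hs ht Hg Hdg HF.
set (Is := fun t a b => RIntC (fun s => F (z0 + RtoC t * g s) * (RtoC t * dg s))%C a b).
set (It := fun s c d => RIntC (fun t => F (z0 + RtoC t * g s) * g s)%C c d).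
(* [Om] is the integral of [F] around the image of the boundary of a parameter rectangle. *)
set (Om := fun a b c d => (Is d a b - Is c a b - It b c d + It a c d)%C).
assert (Ds : forall t s, is_Pderive (fun s => z0 + RtoC t * g s)%C s (RtoC t * dg s)%C).
{ intros t s; exact (is_Pderive_comp _ _ _ _ _ (is_Cderive_affine z0 (RtoC t) (g s)) (Hg s)). }
assert (Dt : forall s t, is_Pderive (fun t => z0 + RtoC t * g s)%C t (g s)).
{ intros s t; refine (is_derive_ext (V:=C_R_NormedModule) _ _ t _ _
    (is_Pderive_affine z0 (g s) t)); intros u; now rewrite Cmult_comm. }
assert (Cs : forall t s, continuous ((fun s => RtoC t * dg s)%C : R -> C_UniformSpace) s).
{ intros t s; apply continuous_Cmult; [apply continuous_const|apply Hdg]. }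
assert (Ct : forall s t : R, continuous ((fun _ => g s) : R -> C_UniformSpace) t).
{ intros s t; apply continuous_const. }
assert (es : forall t a b, t1 <= t <= t2 -> s1 <= a -> a <= b -> b <= s2 ->
  ex_RIntC (fun s => F (z0 + RtoC t * g s) * (RtoC t * dg s))%C a b).
{ intros t a b h1 h2 h3 h4; apply ex_RIntC_continuous; [assumption|]; intros s h5.
  apply continuous_Cmult; [|apply Cs].
  destruct (HF s t) as [l Hl]; [lra|lra|].
  exact (continuous_C_comp F (fun s => z0 + RtoC t * g s)%C s l Hl
    (is_Pderive_continuous _ _ _ (Ds t s))). }
assert (et : forall s c d, s1 <= s <= s2 -> t1 <= c -> c <= d -> d <= t2 ->
  ex_RIntC (fun t => F (z0 + RtoC t * g s) * g s)%C c d).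
{ intros s c d h1 h2 h3 h4; apply ex_RIntC_continuous; [assumption|]; intros t h5.
  apply continuous_Cmult; [|apply Ct].
  destruct (HF s t) as [l Hl]; [lra|lra|].
  exact (continuous_C_comp F (fun t => z0 + RtoC t * g s)%C t l Hl
    (is_Pderive_continuous _ _ _ (Dt s t))). }
enough (H : Cmod (Om s1 s2 t1 t2) <= 0).
{ assert (E : Om s1 s2 t1 t2 = RtoC 0).
  { apply Cmod_eq_0; generalize (Cmod_ge_0 (Om s1 s2 t1 t2)); lra. }
  unfold Om, Is, It in E.
  match goal with |- (?a - ?b = ?c - ?d)%C =>
    replace (a - b)%C with ((a - b - c + d) + (c - d))%C by ring end.
  rewrite E; ring. }
apply (bisection_rectangle (fun a b c d => Cmod (Om a b c d))); auto.
- intros a b c d h1 h2 h3 h4 h5 h6.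
  set (m := (a + b) / 2); set (n := (c + d) / 2).
  assert (hm : a <= m <= b) by (unfold m; lra); assert (hn : c <= n <= d) by (unfold n; lra).
  replace (Om a b c d) with (Om a m c n + Om a m n d + Om m b c n + Om m b n d)%C.
  + eapply Rle_trans; [apply Cmod_triangle|apply Rplus_le_compat_r].
    eapply Rle_trans; [apply Cmod_triangle|apply Rplus_le_compat_r].
    apply Cmod_triangle.
  + unfold Om, Is, It.
    rewrite (RIntC_Chasles (fun s => F (z0 + RtoC d * g s) * (RtoC d * dg s))%C a m b)
      by (apply es; lra).
    rewrite (RIntC_Chasles (fun s => F (z0 + RtoC c * g s) * (RtoC c * dg s))%C a m b)
      by (apply es; lra).
    rewrite (RIntC_Chasles (fun t => F (z0 + RtoC t * g b) * g b)%C c n d) by (apply et; lra).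
    rewrite (RIntC_Chasles (fun t => F (z0 + RtoC t * g a) * g a)%C c n d) by (apply et; lra).
    ring.
- intros p q hp hq e he.
  destruct (Cmod_continuous_bounded g s1 s2) as [B1 [hB1 HB1]].
  { intros s _; apply (is_Pderive_continuous _ _ _ (Hg s)). }
  destruct (Cmod_continuous_bounded dg s1 s2) as [B2 [hB2 HB2]]; [auto|].
  set (T := 1 + Rabs t1 + Rabs t2).
  assert (hT : forall t, t1 <= t <= t2 -> Rabs t <= T).
  { intros t h; unfold T, Rabs; repeat destruct Rcase_abs; lra. }
  assert (hT1 : 1 <= T) by (unfold T; generalize (Rabs_pos t1) (Rabs_pos t2); lra).
  set (K := T * (B1 + B2)).
  assert (hK : 0 < K) by (unfold K; apply Rmult_lt_0_compat; lra).
  assert (K1 : B1 <= K) by (unfold K; nra).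
  assert (K2 : forall t s, t1 <= t <= t2 -> s1 <= s <= s2 -> Cmod (RtoC t * dg s) <= K).
  { intros t s h1 h2; rewrite Cmod_mult, Cmod_R; unfold K.
    apply Rmult_le_compat; [apply Rabs_pos|apply Cmod_ge_0|auto|].
    generalize (HB2 s h2); lra. }
  destruct (HF p q hp hq) as [l Hl].
  set (w := (z0 + RtoC q * g p)%C) in *.
  (* The final estimate loses one factor [K] through the distance to [w], one through the speed of
     the path, and 2 because the four sides have total parameter length [2 * L]. *)
  set (e1 := e / (2 * K * K)).
  assert (he1 : 0 < e1) by (unfold e1; apply Rdiv_lt_0_compat; [lra|nra]).
  destruct (proj1 (is_Cderive_eps F w l) Hl e1 he1) as [d0 [hd0 Hd0]].
  exists (d0 / K); split; [now apply Rdiv_lt_0_compat|].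
  intros a b c d h1 h2 h3 h4 h5 h6 h7.
  set (L := (b - a) + (d - c)) in *.
  assert (hL : K * L < d0).
  { apply Rmult_lt_reg_r with (/ K); [now apply Rinv_0_lt_compat|].
    replace (K * L * / K) with L by (field; lra); exact h7. }
  assert (hL0 : 0 <= L) by (unfold L; lra).
  assert (near : forall s t, a <= s <= b -> c <= t <= d ->
     Cmod ((z0 + RtoC t * g s) - w) <= K * L).
  { assert (lip : forall u v, a <= u -> u <= v -> v <= b -> Cmod (g v - g u) <= (v - u) * B2).
    { intros u v k1 k2 k3; rewrite <- (RIntC_derive g dg u v); auto.
      apply Cmod_RIntC_le; [assumption|now apply ex_RIntC_continuous|].
      intros s k4; apply HB2; lra. }
    intros s t k1 k2.
    replace (z0 + RtoC t * g s - w)%C with (RtoC t * (g s - g p) + RtoC (t - q) * g p)%C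
      by (unfold w; rewrite RtoC_minus; ring).
    eapply Rle_trans; [apply Cmod_triangle|]; rewrite !Cmod_mult, !Cmod_R.
    assert (Cmod (g s - g p) <= (b - a) * B2).
    { destruct (Rle_dec s p).
      - rewrite Cmod_minus_sym; apply Rle_trans with ((p - s) * B2); [apply lip; lra|].
        apply Rmult_le_compat_r; lra.
      - apply Rle_trans with ((s - p) * B2); [apply lip; lra|].
        apply Rmult_le_compat_r; lra. }
    assert (Rabs (t - q) <= d - c) by (apply Rabs_le; lra).
    assert (Rabs t * Cmod (g s - g p) <= T * ((b - a) * B2)).
    { apply Rmult_le_compat; auto using Rabs_pos, Cmod_ge_0; apply hT; lra. }
    assert (Rabs (t - q) * Cmod (g p) <= (d - c) * B1).
    { apply Rmult_le_compat; auto using Rabs_pos, Cmod_ge_0; apply HB1; lra. }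
    assert ((d - c) * B1 <= T * (d - c) * B1).
    { apply Rmult_le_compat_r; [lra|]; nra. }
    unfold K, L.
    assert (0 <= T * (b - a) * B1) by (repeat apply Rmult_le_pos; lra).
    assert (0 <= T * (d - c) * B2) by (repeat apply Rmult_le_pos; lra).
    lra. }
  (* [qq] is the tangent map of [F] at [w], and [QQ] is a primitive of it whose corner values cancel
     around the boundary. *)
  set (qq := fun z => (F w + l * (z - w))%C).
  set (QQ := fun z => (F w * z + l * ((z - w) * (z - w)) / 2)%C).
  assert (n2 : RtoC 2 <> RtoC 0) by (intros E; apply RtoC_inj in E; lra).
  assert (Dm : forall z, is_Cderive (fun z => z - w)%C z (RtoC 1)).
  { intros z; refine (is_Cderive_eq _ _ _ _ (is_Cderive_minus _ _ z _ _ (is_Cderive_id z)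
      (is_Cderive_const w z)) _); ring. }
  assert (DQ : forall z, is_Cderive QQ z (qq z)).
  { intros z; refine (is_Cderive_eq _ _ _ _ (is_Cderive_plus _ _ z _ _
      (is_Cderive_mult _ _ z _ _ (is_Cderive_const (F w) z) (is_Cderive_id z))
      (is_Cderive_mult _ _ z _ _ (is_Cderive_mult _ _ z _ _ (is_Cderive_const l z)
        (is_Cderive_mult _ _ z _ _ (Dm z) (Dm z))) (is_Cderive_const (/ 2)%C z))) _).
    unfold qq; field; auto. }
  assert (Dq : forall z, exists k, is_Cderive qq z k).
  { intros z; eexists; exact (is_Cderive_plus _ _ z _ _ (is_Cderive_const (F w) z)
      (is_Cderive_mult _ _ z _ _ (is_Cderive_const l z) (Dm z))). }
  assert (Hq : forall s t, a <= s <= b -> c <= t <= d ->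
     Cmod (F (z0 + RtoC t * g s)%C - qq (z0 + RtoC t * g s)%C) <= e1 * (K * L)).
  { intros s t k1 k2; specialize (near s t k1 k2); unfold qq.
    set (z := (z0 + RtoC t * g s)%C) in *.
    replace (F z - (F w + l * (z - w)))%C with (F z - F w - l * (z - w))%C by ring.
    eapply Rle_trans; [apply Hd0; lra|]; apply Rmult_le_compat_l; lra. }
  assert (hM : 0 <= e1 * (K * L)) by (apply Rmult_le_pos; [lra|apply Rmult_le_pos; lra]).
  set (M := e1 * (K * L) * K).
  assert (side_s : forall t, c <= t <= d -> Cmod (Is t a b
     - (QQ (z0 + RtoC t * g b)%C - QQ (z0 + RtoC t * g a)%C)) <= (b - a) * M).
  { intros t k; unfold Is.
    apply (path_integral_approx F qq QQ (fun s => z0 + RtoC t * g s)%C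
      (fun s => RtoC t * dg s)%C); auto; [lra| |].
    - intros s k'; apply HF; lra.
    - intros s k'; apply Rmult_le_compat; auto using Cmod_ge_0; apply K2; lra. }
  assert (side_t : forall s, a <= s <= b -> Cmod (It s c d
     - (QQ (z0 + RtoC d * g s)%C - QQ (z0 + RtoC c * g s)%C)) <= (d - c) * M).
  { intros s k; unfold It.
    apply (path_integral_approx F qq QQ (fun t => z0 + RtoC t * g s)%C
      (fun _ => g s)); auto; [lra| |].
    - intros t k'; apply HF; lra.
    - intros t k'; apply Rmult_le_compat; auto using Cmod_ge_0.
      apply Rle_trans with (2 := K1), HB1; lra. }
  assert (E1 := side_s d ltac:(lra)); assert (E2 := side_s c ltac:(lra)).
  assert (E3 := side_t b ltac:(lra)); assert (E4 := side_t a ltac:(lra)).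
  unfold Om.
  match type of E1 with Cmod ?x <= _ => set (x1 := x) in * end.
  match type of E2 with Cmod ?x <= _ => set (x2 := x) in * end.
  match type of E3 with Cmod ?x <= _ => set (x3 := x) in * end.
  match type of E4 with Cmod ?x <= _ => set (x4 := x) in * end.
  replace (Is d a b - Is c a b - It b c d + It a c d)%C with (x1 - x2 - x3 + x4)%C
    by (unfold x1, x2, x3, x4; ring).
  assert (T1 := Cmod_triangle (x1 - x2 - x3) x4).
  assert (T2 := Cmod_triangle (x1 - x2) (- x3)); assert (T3 := Cmod_triangle x1 (- x2)).
  rewrite Cmod_opp in T2, T3; fold (Cminus (x1 - x2) x3) in T2; fold (Cminus x1 x2) in T3.
  replace (e * L ^ 2) with (2 * (L * M)) by (unfold M, e1; field; lra).
  unfold L at 1; lra.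
Qed.

(** * Exponential, logarithm, primitives and Cauchy's formula *)

Lemma continuous_affine_path (z h : C) s :
  continuous ((fun s => z + RtoC s * h)%C : R -> C_UniformSpace) s.
Proof.
apply continuous_Cplus; [apply continuous_const|].
apply continuous_Cmult; [apply continuous_RtoC|apply continuous_const].
Qed.

(** The average of [q] over a short segment starting at [z] is close to [q z] by continuity, so the
    difference quotients of [G] converge to [q z] uniformly in the direction. *)
Lemma is_Cderive_line_integral (G q : C -> C) z r :
  0 < r ->
  (forall w, Cmod (w - z) < r -> continuous (q : C_UniformSpace -> C_UniformSpace) w) ->
  (forall h, Cmod h < r ->
     (G (z + h) - G z)%C = RIntC (fun s => q (z + RtoC s * h) * h)%C 0 1) ->
  is_Cderive G z (q z).
Proof.
intros hr Hq HG; apply is_Cderive_eps; intros e he.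
assert (h0 : Cmod (z - z) < r) by (replace (z - z)%C with (RtoC 0) by ring; rewrite Cmod_0; lra).
destruct (proj1 (continuous_C_eps q z) (Hq z h0) e he) as [d Hd].
assert (hd := cond_pos d).
assert (Hd' : forall w, Cmod (w - z) < d -> Cmod (q w - q z) < e).
{ intros w hw; apply Hd; exact (C_NormedModule_mixin_compat1 z w d hw). }
exists (Rmin r d); split; [apply Rmin_glb_lt; lra|]; intros y hy.
set (h := (y - z)%C) in *.
assert (h1 := Rlt_le_trans _ _ _ hy (Rmin_l _ _)).
assert (h2 := Rlt_le_trans _ _ _ hy (Rmin_r _ _)).
specialize (HG h h1); replace (z + h)%C with y in HG by (unfold h; ring).
assert (B : forall s, 0 <= s <= 1 -> Cmod (z + RtoC s * h - z) <= Cmod h).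
{ intros s hs; replace (z + RtoC s * h - z)%C with (RtoC s * h)%C by ring.
  rewrite Cmod_mult, Cmod_R, Rabs_right by lra.
  generalize (Cmod_ge_0 h); nra. }
assert (ct : forall s, 0 <= s <= 1 ->
  continuous ((fun s => q (z + RtoC s * h) * h)%C : R -> C_UniformSpace) s).
{ intros s hs; apply continuous_Cmult; [|apply continuous_const].
  apply (continuous_comp (U:=R_UniformSpace) (V:=C_UniformSpace) (W:=C_UniformSpace)
    (fun s => z + RtoC s * h)%C q); [apply continuous_affine_path|].
  apply Hq; generalize (B s hs); lra. }
rewrite HG.
replace (q z * h)%C with (RIntC (fun _ => q z * h)%C 0 1) by (rewrite RIntC_const, RtoC_minus; ring_C).
rewrite <- RIntC_minus.
- apply Rle_trans with ((1 - 0) * (e * Cmod h)); [|lra].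
  apply Cmod_RIntC_le; [lra| |].
  + apply ex_RIntC_continuous; [lra|]; intros s hs; apply continuous_Cminus; auto.
    apply continuous_const.
  + intros s hs.
    replace (q (z + RtoC s * h) * h - q z * h)%C with ((q (z + RtoC s * h) - q z) * h)%C by ring.
    rewrite Cmod_mult; apply Rmult_le_compat_r; [apply Cmod_ge_0|].
    left; apply Hd'; generalize (B s hs); lra.
- apply ex_RIntC_continuous; [lra|auto].
- apply ex_RIntC_continuous; [lra|intros; apply continuous_const].
Qed.

Lemma is_Cderive_continuous_C (f : C -> C) z l :
  is_Cderive f z l -> continuous (f : C_UniformSpace -> C_UniformSpace) z.
Proof.
intros H; exact (continuous_C_comp f (fun w : C_UniformSpace => w) z l H (@continuous_id C_UniformSpace z)).
Qed.

(** Reduces complex differentiability to derivatives along real lines, provided that they come from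
    one continuous [q]. This lets [Cexp] and [Clog] be treated by real calculus on their
    components. *)
Lemma is_Cderive_lines (G q : C -> C) z r :
  0 < r ->
  (forall w, Cmod (w - z) < r -> continuous (q : C_UniformSpace -> C_UniformSpace) w) ->
  (forall h s, Cmod (z + RtoC s * h - z) < r ->
     is_Pderive (fun s => G (z + RtoC s * h)%C) s (q (z + RtoC s * h) * h)%C) ->
  is_Cderive G z (q z).
Proof.
intros hr Hq HG; apply (is_Cderive_line_integral G q z r); auto.
intros h hh.
assert (B : forall s, 0 <= s <= 1 -> Cmod (z + RtoC s * h - z) < r).
{ intros s hs; replace (z + RtoC s * h - z)%C with (RtoC s * h)%C by ring.
  rewrite Cmod_mult, Cmod_R, Rabs_right by lra.
  generalize (Cmod_ge_0 h); nra. }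
rewrite (RIntC_derive (fun s => G (z + RtoC s * h)%C)); [|lra| |].
- f_equal; [|f_equal]; f_equal; ring.
- intros s hs; apply HG; auto.
- intros s hs; apply continuous_Cmult; [|apply continuous_const].
  apply (continuous_comp (U:=R_UniformSpace) (V:=C_UniformSpace) (W:=C_UniformSpace)
    (fun s => z + RtoC s * h)%C q); [apply continuous_affine_path|]; auto.
Qed.

Lemma is_Cderive_Cexp z : is_Cderive Cexp z (Cexp z).
Proof.
apply (is_Cderive_lines Cexp Cexp z 1 Rlt_0_1).
- intros w _.
  apply (continuous_comp_2 (U:=C_UniformSpace) (V:=R_UniformSpace) (W:=R_UniformSpace)
    (X:=C_UniformSpace) (fun w => exp (Re w) * cos (Im w)) (fun w => exp (Re w) * sin (Im w))
    (fun x y => (x, y)));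
  [| |apply (continuous_ext (fun p : prod_UniformSpace R_UniformSpace R_UniformSpace => p));
    [now intros []|apply continuous_id]].
  + apply (continuous_mult (K:=R_AbsRing)
      (fun w : C_UniformSpace => exp (Re w)) (fun w : C_UniformSpace => cos (Im w)));
    [apply (continuous_comp (U:=C_UniformSpace) Re exp); [apply continuous_fst|apply continuous_exp]
    |apply (continuous_comp (U:=C_UniformSpace) Im cos); [apply continuous_snd|apply continuous_cos]].
  + apply (continuous_mult (K:=R_AbsRing)
      (fun w : C_UniformSpace => exp (Re w)) (fun w : C_UniformSpace => sin (Im w)));
    [apply (continuous_comp (U:=C_UniformSpace) Re exp); [apply continuous_fst|apply continuous_exp]
    |apply (continuous_comp (U:=C_UniformSpace) Im sin); [apply continuous_snd|apply continuous_sin]].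
- intros [a b] s _; destruct z as [x y].
  refine (is_Pderive_eq _ _ _ _ (is_Pderive_pair
    (fun s => exp (x + (s * a - 0 * b)) * cos (y + (s * b + 0 * a)))
    (fun s => exp (x + (s * a - 0 * b)) * sin (y + (s * b + 0 * a))) s _ _ _ _) _);
  [auto_derive; [auto|reflexivity]|auto_derive; [auto|reflexivity]|].
  unfold Cexp, Cmult, Cplus, RtoC, Re, Im; simpl; unfold Rminus; f_equal; ring.
Qed.

(** The two branches of [Carg] join into one formula that is smooth across the positive real axis.
    Every later argument of [Clog] lies in this half-plane. *)
Lemma Clog_right_half_plane (w : C) :
  0 < Re w -> Clog w = (ln (sqrt (Re w ^ 2 + Im w ^ 2)), atan (Im w / Re w)).
Proof.
destruct w as [x y]; unfold Clog, Carg, Cmod, Re, Im; simpl fst; simpl snd; intros hx.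
f_equal; set (m := sqrt (x ^ 2 + y ^ 2)).
assert (hm2 : m * m = x ^ 2 + y ^ 2) by (apply sqrt_sqrt; nra).
assert (hm : 0 < m) by (apply sqrt_lt_R0; nra).
(* [acos] only sees |y|; the case distinction in [Carg] restores the sign. *)
assert (E : acos (x / m) = atan (Rabs y / x)).
{ rewrite acos_atan by now apply Rdiv_lt_0_compat.
  f_equal; replace (sqrt (1 - (x / m)²)) with (Rabs y / m); [field; lra|].
  symmetry; apply sqrt_lem_1.
  - replace (1 - (x / m)²) with ((y / m)²); [apply Rle_0_sqr|].
    unfold Rsqr, Rdiv.
    replace 1 with ((m * m) * (/ m * / m)) by (field; lra); rewrite hm2; ring.
  - apply Rmult_le_pos; [apply Rabs_pos|left; now apply Rinv_0_lt_compat].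
  - replace (Rabs y / m * (Rabs y / m)) with ((Rabs y * Rabs y) / (m * m)) by (field; lra).
    rewrite <- Rabs_mult, Rabs_right by nra.
    unfold Rsqr; replace (x / m * (x / m)) with (x ^ 2 / (m * m)) by (field; lra).
    rewrite hm2; field; nra. }
rewrite E; destruct (Rle_dec 0 y) as [h|h].
- now rewrite Rabs_right by lra.
- rewrite Rabs_left by lra; rewrite <- atan_opp; f_equal; field; lra.
Qed.

Lemma is_Cderive_Clog w : 0 < Re w -> is_Cderive Clog w (/ w)%C.
Proof.
intros hw.
assert (near : forall v, Cmod (v - w) < Re w -> 0 < Re v).
{ intros v hv; assert (H := Rle_lt_trans _ _ _ (re_le_Cmod (v - w)) hv).
  destruct v, w; simpl in *; apply Rabs_lt_between in H; lra. }
assert (nz : forall v, 0 < Re v -> v <> RtoC 0).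
{ intros v hv E; rewrite E in hv; simpl in hv; lra. }
apply (is_Cderive_lines Clog Cinv w (Re w) hw).
- intros v hv; apply (is_Cderive_continuous_C _ _ _ (is_Cderive_inv v (nz v (near v hv)))).
- intros h s hs.
  set (u := fun s => Re w + s * Re h); set (v := fun s => Im w + s * Im h).
  assert (E : forall s, (w + RtoC s * h)%C = (u s, v s)).
  { intros t; unfold u, v; destruct w, h; unfold Cplus, Cmult, RtoC, Re, Im; simpl; f_equal; ring. }
  assert (hu : 0 < u s) by (generalize (near _ hs); rewrite E; exact (fun H => H)).
  apply (is_derive_ext_loc (V:=C_R_NormedModule)
    (fun s => (ln (sqrt (u s ^ 2 + v s ^ 2)), atan (v s / u s)) : C)).
  + assert (cu : continuous u s).
    { apply (ex_derive_continuous (V:=R_NormedModule)); unfold u; auto_derive; auto. }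
    assert (L : locally s (fun t => 0 < u t)).
    { apply (cu (fun x => 0 < x)); exists (mkposreal _ hu); intros x hx.
      change (Rabs (x - u s) < u s) in hx; apply Rabs_lt_between in hx; lra. }
    revert L; apply filter_imp; intros t ht; rewrite E, Clog_right_half_plane; auto.
  + assert (hp : 0 < u s ^ 2 + v s ^ 2) by nra.
    assert (hq := sqrt_lt_R0 _ hp).
    assert (hq2 : sqrt (u s ^ 2 + v s ^ 2) * sqrt (u s ^ 2 + v s ^ 2) = u s ^ 2 + v s ^ 2)
      by (apply sqrt_sqrt; lra).
    rewrite E; refine (is_Pderive_eq _ _ _ _ (is_Pderive_pair _ _ s
      ((u s * Re h + v s * Im h) / (u s ^ 2 + v s ^ 2))
      ((u s * Im h - v s * Re h) / (u s ^ 2 + v s ^ 2)) _ _) _).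
    * unfold u, v in *; auto_derive; [repeat split; auto; lra|].
      simpl in hq, hq2 |- *; match type of hq with 0 < ?q0 => set (q := q0) in * end.
      rewrite <- hq2; field; lra.
    * unfold u, v in *; auto_derive; [lra|]; unfold Rsqr; field; repeat split; try nra; lra.
    * destruct h as [a b]; unfold Cinv, Cmult, Re, Im; simpl; f_equal; field; nra.
Qed.

Lemma in_disk_convex (z h : C) s : in_disk z -> in_disk (z + h) -> 0 <= s <= 1 ->
  in_disk (z + RtoC s * h).
Proof.
unfold in_disk; intros h1 h2 hs.
replace (z + RtoC s * h)%C with (RtoC (1 - s) * z + RtoC s * (z + h))%C
  by (rewrite RtoC_minus; ring).
eapply Rle_lt_trans; [apply Cmod_triangle|].
rewrite !Cmod_mult, !Cmod_R, !Rabs_right by lra.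
destruct (Req_dec s 0) as [->|]; [lra|].
assert (s * Cmod (z + h) < s * 1) by (apply Rmult_lt_compat_l; lra).
assert ((1 - s) * Cmod z <= (1 - s) * 1) by (apply Rmult_le_compat_l; lra); lra.
Qed.

Lemma in_disk_scal (z : C) s : in_disk z -> 0 <= s <= 1 -> in_disk (RtoC s * z).
Proof.
unfold in_disk; intros h hs; rewrite Cmod_mult, Cmod_R, Rabs_right by lra.
generalize (Cmod_ge_0 z); nra.
Qed.

Lemma is_Cderive_segment_int (g : C -> C) z :
  analytic_on_disk g -> in_disk z -> is_Cderive (segment_int g) z (g z).
Proof.
intros Hg hz.
assert (near : forall w, Cmod (w - z) < 1 - Cmod z -> in_disk w).
{ intros w hw; unfold in_disk; generalize (Cmod_reverse_triangle w z); lra. }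
apply (is_Cderive_line_integral (segment_int g) g z (1 - Cmod z)).
- unfold in_disk in hz; lra.
- intros w hw; destruct (Hg w (near w hw)) as [l Hl].
  apply (is_Cderive_continuous_C _ _ _ Hl).
- intros h hh.
  assert (hzh : in_disk (z + h)).
  { apply near; replace (z + h - z)%C with h by ring; assumption. }
  (* The cone with apex 0 over the segment from [z] to [z + h] is a triangle whose sides carry the
     three integrals to be compared; its side at [t = 0] collapses to the apex and contributes 0. *)
  assert (G := Goursat_cone g 0 (fun s => z + RtoC s * h)%C (fun _ => h) 0 1 0 1
    ltac:(lra) ltac:(lra)).
  assert (D : forall s, is_Pderive (fun s => z + RtoC s * h)%C s h).
  { intros s; refine (is_derive_ext (V:=C_R_NormedModule) _ _ s _ _ (is_Pderive_affine z h s)).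
    intros u; now rewrite Cmult_comm. }
  specialize (G D (fun s => continuous_const _ _)).
  assert (HF : forall s t, 0 <= s <= 1 -> 0 <= t <= 1 ->
    exists l, is_Cderive g (0 + RtoC t * (z + RtoC s * h))%C l).
  { intros s t hs ht; apply Hg; rewrite Cplus_0_l; apply in_disk_scal; auto.
    apply in_disk_convex; auto. }
  specialize (G HF); symmetry in G.
  unfold segment_int.
  rewrite (RIntC_ext (fun t => g (RtoC t * (z + h)) * (z + h))%C
    (fun t => g (0 + RtoC t * (z + RtoC 1 * h)) * (z + RtoC 1 * h))%C).
  2: lra. 2: intros t _; f_equal; [f_equal|]; ring_C.
  rewrite (RIntC_ext (fun t => g (RtoC t * z) * z)%C
    (fun t => g (0 + RtoC t * (z + RtoC 0 * h)) * (z + RtoC 0 * h))%C).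
  2: lra. 2: intros t _; f_equal; [f_equal|]; ring_C.
  rewrite G.
  rewrite (RIntC_ext (fun s => g (0 + RtoC 0 * (z + RtoC s * h)) * (RtoC 0 * h))%C
    (fun _ => RtoC 0)).
  2: lra. 2: intros t _; ring.
  rewrite RIntC_const.
  rewrite (RIntC_ext (fun s => g (0 + RtoC 1 * (z + RtoC s * h)) * (RtoC 1 * h))%C
    (fun s => g (z + RtoC s * h) * h)%C).
  2: lra. 2: intros t _; f_equal; [f_equal|]; ring_C.
  ring.
Qed.

(** * Cauchy's formula on circles centred at the origin *)

Definition circle (r s : R) : C := (r * cos s, r * sin s).

Lemma Cmod_circle r s : 0 <= r -> Cmod (circle r s) = r.
Proof.
intros hr; unfold Cmod, circle; simpl fst; simpl snd.
replace ((r * cos s) ^ 2 + (r * sin s) ^ 2) with (r * r).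
- now apply sqrt_square.
- generalize (sin2_cos2 s); unfold Rsqr; intros H.
  replace ((r * cos s) ^ 2 + (r * sin s) ^ 2)
    with (r * r * (sin s * sin s + cos s * cos s)) by ring; rewrite H; ring.
Qed.

Lemma is_Pderive_circle r s : is_Pderive (circle r) s (Ci * circle r s)%C.
Proof.
refine (is_Pderive_eq _ _ _ _ (is_Pderive_pair (fun s => r * cos s) (fun s => r * sin s)
  s (- r * sin s) (r * cos s) _ _) _).
- auto_derive; auto; ring.
- auto_derive; auto; ring.
- unfold Ci, circle, Cmult; simpl; f_equal; ring.
Qed.

Lemma continuous_circle r s : continuous (circle r : R -> C_UniformSpace) s.
Proof. apply (is_Pderive_continuous _ _ _ (is_Pderive_circle r s)). Qed.

Lemma circle_minus_neq_0 r (a : C) s : Cmod a < r -> (circle r s - a)%C <> RtoC 0.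
Proof.
intros ha; apply Cmod_gt_0.
generalize (Cmod_reverse_triangle (circle r s) a) (Cmod_ge_0 a).
intros H H1; rewrite Cmod_circle in H by lra; lra.
Qed.

Lemma continuous_Cdiv {U : UniformSpace} (f g : U -> C) x :
  g x <> RtoC 0 ->
  continuous (f : U -> C_UniformSpace) x -> continuous (g : U -> C_UniformSpace) x ->
  continuous ((fun y => f y / g y)%C : U -> C_UniformSpace) x.
Proof.
intros h Hf Hg; apply continuous_Cmult; [assumption|].
exact (continuous_C_comp Cinv g x _ (is_Cderive_inv _ h) Hg).
Qed.

(** On the circle, a logarithm of z - a is log z + log (1 - a / z). The second term is single-valued
    because 1 - a / z stays in the right half-plane, and the first is [Ci * s] up to a constant,
    whose increment is the result. *)
Lemma winding_number_circle r (a : C) : Cmod a < r ->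
  RIntC (fun s => Ci * circle r s / (circle r s - a))%C 0 (2 * PI) = (RtoC (2 * PI) * Ci)%C.
Proof.
intros ha; assert (hr : 0 < r) by (generalize (Cmod_ge_0 a); lra).
assert (hc : forall s, circle r s <> RtoC 0).
{ intros s; apply Cmod_gt_0; rewrite Cmod_circle; lra. }
rewrite (RIntC_derive (fun s => Clog (1 - a / circle r s) + Ci * RtoC s)%C).
- unfold circle; rewrite sin_2PI, cos_2PI, sin_0, cos_0; ring_C.
- generalize PI_RGT_0; lra.
- intros s _.
  assert (hre : 0 < Re (1 - a / circle r s)%C).
  { assert (H : Cmod (a / circle r s) < 1).
    { rewrite Cmod_div, Cmod_circle by (auto; lra).
      apply Rmult_lt_reg_r with r; [lra|]; unfold Rdiv; rewrite Rmult_assoc, Rinv_l; lra. }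
    assert (H1 := Rle_lt_trans _ _ _ (re_le_Cmod _) H).
    destruct (a / circle r s)%C; simpl in *; apply Rabs_lt_between in H1; lra. }
  assert (D1 : is_Cderive (fun z => 1 - a / z)%C (circle r s) (a / (circle r s * circle r s))%C).
  { refine (is_Cderive_eq _ _ _ _ (is_Cderive_minus _ _ _ _ _ (is_Cderive_const 1 _)
      (is_Cderive_div _ _ _ _ _ (hc s) (is_Cderive_const a _) (is_Cderive_id _))) _).
    fold (circle r s); field_C; auto. }
  refine (is_Pderive_eq _ _ _ _ (is_Pderive_plus _ _ s _ _
    (is_Pderive_comp (fun z => Clog (1 - a / z)%C) _ _ _ _
      (is_Cderive_comp Clog (fun z => 1 - a / z)%C _ _ _ (is_Cderive_Clog _ hre) D1)
      (is_Pderive_circle r s))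
    (is_derive_ext (V:=C_R_NormedModule) _ _ s _ _ (is_Pderive_affine 0 Ci s))) _).
  + intros t; simpl; ring_C.
  + field_C; repeat split; auto using circle_minus_neq_0.
- intros s _; apply continuous_Cdiv; [now apply circle_minus_neq_0| |].
  + apply continuous_Cmult; [apply continuous_const|apply continuous_circle].
  + apply continuous_Cminus; [apply continuous_circle|apply continuous_const].
Qed.

Lemma Cauchy_integrand_continuous (f : C -> C) r (a : C) s :
  analytic_on_disk f -> r < 1 -> Cmod a < r ->
  continuous ((fun s => f (circle r s) * (Ci * circle r s) / (circle r s - a))%C
    : R -> C_UniformSpace) s.
Proof.
intros Hf hr ha; assert (0 < r) by (generalize (Cmod_ge_0 a); lra).
apply continuous_Cdiv; [now apply circle_minus_neq_0| |].
- apply continuous_Cmult.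
  + destruct (Hf (circle r s)) as [l Hl]; [unfold in_disk; rewrite Cmod_circle; lra|].
    apply (continuous_C_comp f (circle r) s l Hl), continuous_circle.
  + apply continuous_Cmult; [apply continuous_const|apply continuous_circle].
- apply continuous_Cminus; [apply continuous_circle|apply continuous_const].
Qed.

(** The circle is contracted towards [a] by a factor [t]. By [Goursat_cone] the integral [J t] of (f
    - f(a)) / (w - a) along it does not change while [t] remains positive, and continuity of [f] at
    [a] alone makes it tend to 0. The term f(a) / (w - a) is left to the winding number. *)
Lemma Cauchy_formula (f : C -> C) r (a : C) :
  analytic_on_disk f -> r < 1 -> Cmod a < r ->
  RIntC (fun s => f (circle r s) * (Ci * circle r s) / (circle r s - a))%C 0 (2 * PI)
  = (f a * (RtoC (2 * PI) * Ci))%C.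
Proof.
intros Hf hr ha; assert (hr0 : 0 < r) by (generalize (Cmod_ge_0 a); lra).
assert (hpi := PI_RGT_0).
set (g := fun s => (circle r s - a)%C); set (dg := fun s => (Ci * circle r s)%C).
assert (hg : forall s, g s <> RtoC 0) by (intros s; now apply circle_minus_neq_0).
assert (Dg : forall s, is_Pderive g s (dg s)).
{ intros s; refine (is_Pderive_eq _ _ _ _ (is_Pderive_minus _ _ s _ _ (is_Pderive_circle r s)
    (is_Pderive_const a s)) _); unfold dg; ring_C. }
assert (Cg : forall s, continuous (g : R -> C_UniformSpace) s).
{ intros s; apply (is_Pderive_continuous _ _ _ (Dg s)). }
assert (Cdg : forall s, continuous (dg : R -> C_UniformSpace) s).
{ intros s; apply continuous_Cmult; [apply continuous_const|apply continuous_circle]. }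
set (J := fun t => RIntC (fun s => (f (a + RtoC t * g s) - f a) * dg s / g s)%C 0 (2 * PI)).
assert (inD : forall s t, 0 <= t <= 1 -> in_disk (a + RtoC t * g s)).
{ intros s t ht; apply in_disk_convex; auto; unfold in_disk, g; [lra|].
  replace (a + (circle r s - a))%C with (circle r s) by ring; rewrite Cmod_circle; lra. }
assert (CJ : forall t s, 0 <= t <= 1 ->
  continuous ((fun s => (f (a + RtoC t * g s) - f a) * dg s / g s)%C : R -> C_UniformSpace) s).
{ intros t s ht; apply continuous_Cdiv; auto; apply continuous_Cmult; auto.
  apply continuous_Cminus; [|apply continuous_const].
  destruct (Hf _ (inD s t ht)) as [l Hl].
  apply (continuous_C_comp f (fun s => a + RtoC t * g s)%C s l Hl).
  apply continuous_Cplus; [apply continuous_const|].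
  apply continuous_Cmult; [apply continuous_const|auto]. }
assert (J1 : forall t, 0 < t <= 1 -> J 1 = J t).
{ intros t ht.
  assert (G := Goursat_cone (fun w => (f w - f a) / (w - a))%C a g dg 0 (2 * PI) t 1
    ltac:(lra) ltac:(lra) Dg Cdg).
  assert (nz : forall s u, t <= u <= 1 -> (a + RtoC u * g s - a)%C <> RtoC 0).
  { intros s u hu; replace (a + RtoC u * g s - a)%C with (RtoC u * g s)%C by ring_C.
    apply Cmult_neq_0; [|auto]; intros E; apply RtoC_inj in E; lra. }
  assert (HF : forall s u, 0 <= s <= 2 * PI -> t <= u <= 1 ->
    exists l, is_Cderive (fun w => (f w - f a) / (w - a))%C (a + RtoC u * g s)%C l).
  { intros s u hs hu; destruct (Hf _ (inD s u ltac:(lra))) as [l Hl]; ex_Cderive; auto. }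
  specialize (G HF).
  (* The curve is closed, so the two lateral sides of the cone carry the same integral and
     cancel. *)
  replace (g (2 * PI)) with (g 0) in G
    by (unfold g, circle; now rewrite sin_2PI, cos_2PI, sin_0, cos_0).
  match type of G with (_ = ?x - ?x)%C => replace (x - x)%C with (RtoC 0) in G by ring_C end.
  assert (EJ : forall u, t <= u <= 1 -> J u
    = RIntC (fun s => (f (a + RtoC u * g s) - f a) / (a + RtoC u * g s - a)
                      * (RtoC u * dg s))%C 0 (2 * PI)).
  { intros u hu; apply RIntC_ext; [lra|]; intros s _.
    assert (RtoC u <> RtoC 0) by (intros E; apply RtoC_inj in E; lra).
    replace (a + RtoC u * g s - a)%C with (RtoC u * g s)%C by ring; field_C; auto. }
  rewrite (EJ 1), (EJ t) by lra.
  match type of G with (?x - ?y = _)%C =>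
    replace x with ((x - y) + y)%C by ring; rewrite G; ring_C end. }
assert (J0 : J 1 = RtoC 0).
{ apply Cmod_eq_0; apply Rle_antisym; [|apply Cmod_ge_0].
  apply le_epsilon; intros e he; rewrite Rplus_0_l.
  destruct (Cmod_continuous_bounded (fun s => dg s / g s)%C 0 (2 * PI)) as [M [hM HM]].
  { intros s _; apply continuous_Cdiv; auto. }
  destruct (Cmod_continuous_bounded g 0 (2 * PI)) as [M' [hM' HM']]; [auto|].
  destruct (Hf a) as [l Hl]; [unfold in_disk; lra|].
  assert (he1 : 0 < e / (2 * PI * M)) by (apply Rdiv_lt_0_compat; [lra|nra]).
  destruct (is_Cderive_continuous f a l Hl _ he1) as [d [hd Hd]].
  set (t := Rmin 1 (d / (2 * M'))).
  assert (ht : 0 < t) by (apply Rmin_glb_lt; [lra|apply Rdiv_lt_0_compat; lra]).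
  assert (ht1 : t <= 1) by apply Rmin_l.
  assert (ht2 : t * M' < d).
  { apply Rle_lt_trans with (d / (2 * M') * M').
    - apply Rmult_le_compat_r; [lra|apply Rmin_r].
    - replace (d / (2 * M') * M') with (d / 2) by (field_C; lra); lra. }
  rewrite (J1 t) by lra.
  replace e with ((2 * PI - 0) * (e / (2 * PI * M) * M)) by (field_C; lra).
  apply Cmod_RIntC_le; [lra| |].
  - apply ex_RIntC_continuous; [lra|]; intros s _; apply CJ; lra.
  - intros s hs.
    replace ((f (a + RtoC t * g s) - f a) * dg s / g s)%C
      with ((f (a + RtoC t * g s) - f a) * (dg s / g s))%C by (field_C; auto).
    rewrite Cmod_mult; apply Rmult_le_compat; auto using Cmod_ge_0.
    left; apply Hd; replace (a + RtoC t * g s - a)%C with (RtoC t * g s)%C by ring_C.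
    rewrite Cmod_mult, Cmod_R, Rabs_right by lra.
    apply Rle_lt_trans with (2 := ht2), Rmult_le_compat_l; auto; lra. }
rewrite <- (winding_number_circle r a ha), <- RIntC_scal.
2:{ apply ex_RIntC_continuous; [lra|]; intros s _; apply continuous_Cdiv; [apply hg|apply Cdg|apply Cg]. }
match goal with |- ?x = ?y => enough (E : (x - y)%C = RtoC 0);
  [replace x with ((x - y) + y)%C by ring_C; rewrite E; ring_C|] end.
rewrite <- RIntC_minus.
- rewrite <- J0; apply RIntC_ext; [lra|]; intros s _.
  replace (a + RtoC 1 * g s)%C with (circle r s) by (unfold g; ring_C).
  fold (g s); fold (dg s); field_C; auto.
- apply ex_RIntC_continuous; [lra|]; intros s _; now apply Cauchy_integrand_continuous.
- apply ex_RIntC_continuous; [lra|]; intros s _; apply continuous_Cmult; [apply continuous_const|].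
  apply continuous_Cdiv; [apply hg|apply Cdg|apply Cg].
Qed.

(** * Consequences of Cauchy's formula *)

(** Differentiation under the integral sign from a remainder that is quadratic in [w - u] uniformly
    in [s]; the Cauchy kernels give such remainders in closed form. *)
Lemma is_Cderive_RIntC (k : C -> R -> C) (dk : R -> C) (u : C) a b r M :
  a <= b -> 0 < r ->
  (forall w s, Cmod (w - u) < r -> a <= s <= b -> continuous (k w : R -> C_UniformSpace) s) ->
  (forall s, a <= s <= b -> continuous (dk : R -> C_UniformSpace) s) ->
  (forall w s, Cmod (w - u) < r -> a <= s <= b ->
     Cmod (k w s - k u s - dk s * (w - u)) <= M * (Cmod (w - u)) ^ 2) ->
  is_Cderive (fun w => RIntC (k w) a b) u (RIntC dk a b).
Proof.
intros hab hr Hk Hdk HM; apply is_Cderive_eps; intros e he.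
set (K := 1 + (b - a) * Rabs M).
assert (hK : 0 < K) by (generalize (Rabs_pos M); unfold K; nra).
exists (Rmin r (e / K)); split; [apply Rmin_glb_lt; [lra|now apply Rdiv_lt_0_compat]|].
intros w hw.
assert (h1 := Rlt_le_trans _ _ _ hw (Rmin_l _ _)).
assert (h2 := Rlt_le_trans _ _ _ hw (Rmin_r _ _)).
assert (h0 : Cmod (u - u) < r) by (replace (u - u)%C with (RtoC 0) by ring; rewrite Cmod_0; lra).
assert (i1 := ex_RIntC_continuous (k w) a b hab (fun s => Hk w s h1)).
assert (i2 := ex_RIntC_continuous (k u) a b hab (fun s => Hk u s h0)).
assert (i3 := ex_RIntC_continuous dk a b hab Hdk).
assert (c4 : forall s, a <= s <= b ->
  continuous ((fun s => (w - u) * dk s)%C : R -> C_UniformSpace) s).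
{ intros s hs; apply continuous_Cmult; [apply continuous_const|auto]. }
replace (RIntC dk a b * (w - u))%C with ((w - u) * RIntC dk a b)%C by ring_C.
rewrite <- RIntC_scal, <- RIntC_minus, <- RIntC_minus; auto.
- set (h := Cmod (w - u)) in *; assert (hh : 0 <= h) by apply Cmod_ge_0.
  apply Rle_trans with ((b - a) * (Rabs M * h ^ 2)).
  + apply Cmod_RIntC_le; [assumption| |].
    * apply ex_RIntC_continuous; [assumption|]; intros s hs.
      apply continuous_Cminus; [apply continuous_Cminus; [apply (Hk w s h1 hs)|apply (Hk u s h0 hs)]|
        apply (c4 s hs)].
    * intros s hs; rewrite (Cmult_comm (w - u)).
      apply Rle_trans with (1 := HM w s h1 hs), Rmult_le_compat_r; [nra|apply Rle_abs].
  + assert (h * K < e).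
    { apply Rmult_lt_reg_r with (/ K); [now apply Rinv_0_lt_compat|].
      rewrite Rmult_assoc, Rinv_r by lra; unfold Rdiv in h2; lra. }
    apply Rle_trans with ((K - 1) * h * h); [unfold K; right; ring|].
    apply Rmult_le_compat_r; [assumption|]; nra.
- apply ex_RIntC_continuous; [assumption|]; intros s hs.
  apply continuous_Cminus; [apply (Hk w s h1 hs)|apply (Hk u s h0 hs)].
- apply ex_RIntC_continuous; [assumption|]; intros s hs; apply c4; auto.
Qed.

Lemma Cdiv_Cmod_le (x y : C) N D : 0 < D -> Cmod x <= N -> D <= Cmod y ->
  Cmod (x / y) <= N / D.
Proof.
intros hD hx hy.
assert (hy0 : y <> RtoC 0) by (apply Cmod_gt_0; lra).
rewrite Cmod_div by assumption.
apply Rmult_le_compat; [apply Cmod_ge_0|left; apply Rinv_0_lt_compat; lra|assumption|].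
now apply Rinv_le_contravar.
Qed.

(** Half of the distance from [u] to the circle serves both as the radius allowed around [u] and as
    a lower bound for the denominators there. *)
Lemma Cauchy_kernel_lower_bound r (u w : C) s :
  Cmod u < r -> Cmod (w - u) < (r - Cmod u) / 2 ->
  (r - Cmod u) / 2 <= Cmod (circle r s - w) /\ Cmod w < r.
Proof.
intros hu hw; assert (H := Cmod_ge_0 u).
assert (h1 := Cmod_reverse_triangle w u).
assert (h2 := Cmod_reverse_triangle (circle r s) w).
rewrite Cmod_circle in h2 by lra; lra.
Qed.

Lemma is_Cderive_Cauchy_integral (phi : R -> C) r (u : C) :
  (forall s, continuous (phi : R -> C_UniformSpace) s) -> Cmod u < r ->
  is_Cderive (fun w => RIntC (fun s => phi s / (circle r s - w))%C 0 (2 * PI)) u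
    (RIntC (fun s => phi s / ((circle r s - u) * (circle r s - u)))%C 0 (2 * PI)).
Proof.
intros Hphi hu; assert (hpi := PI_RGT_0).
set (rho := (r - Cmod u) / 2); assert (hrho : 0 < rho) by (unfold rho; lra).
assert (hpos : 0 < rho * (rho * rho)) by (apply Rmult_lt_0_compat; nra).
assert (cz : forall (w : C) s,
  continuous ((fun s => circle r s - w)%C : R -> C_UniformSpace) s).
{ intros w s; apply continuous_Cminus; [apply continuous_circle|apply continuous_const]. }
destruct (Cmod_continuous_bounded phi 0 (2 * PI)) as [B [hB HB]]; [auto|].
apply (is_Cderive_RIntC (fun w s => phi s / (circle r s - w))%C _ u 0 (2 * PI) rho
  (B / (rho * (rho * rho)))); [lra|assumption| | |].
- intros w s hw _; apply continuous_Cdiv; auto.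
  apply circle_minus_neq_0; now apply (Cauchy_kernel_lower_bound r u w s).
- intros s _; apply continuous_Cdiv; auto.
  + apply Cmult_neq_0; now apply circle_minus_neq_0.
  + apply continuous_Cmult; apply cz.
- intros w s hw hs.
  destruct (Cauchy_kernel_lower_bound r u w s hu hw) as [h1 h2].
  destruct (Cauchy_kernel_lower_bound r u u s hu) as [h3 _].
  { replace (u - u)%C with (RtoC 0) by ring; rewrite Cmod_0; lra. }
  fold rho in h1, h3.
  assert (n1 := circle_minus_neq_0 r w s h2); assert (n2 := circle_minus_neq_0 r u s hu).
  set (A := (circle r s - u)%C) in *.
  replace (phi s / (circle r s - w) - phi s / A - phi s / (A * A) * (w - u))%C
    with (phi s / ((circle r s - w) * (A * A)) * ((w - u) * (w - u)))%C
    by (unfold A in *; field_C; auto).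
  rewrite Cmod_mult, Cmod_mult; replace (Cmod (w - u) ^ 2) with (Cmod (w - u) * Cmod (w - u)) by ring.
  apply Rmult_le_compat_r; [apply Rmult_le_pos; apply Cmod_ge_0|].
  apply Cdiv_Cmod_le; [exact hpos|auto|].
  rewrite !Cmod_mult; repeat apply Rmult_le_compat; try lra; nra.
Qed.

Lemma is_Cderive_Cauchy_integral2 (phi : R -> C) r (u : C) :
  (forall s, continuous (phi : R -> C_UniformSpace) s) -> Cmod u < r ->
  is_Cderive (fun w => RIntC (fun s => phi s / ((circle r s - w) * (circle r s - w)))%C 0 (2 * PI)) u
    (RIntC (fun s => RtoC 2 * phi s / ((circle r s - u) * ((circle r s - u) * (circle r s - u))))%C
       0 (2 * PI)).
Proof.
intros Hphi hu; assert (hpi := PI_RGT_0).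
set (rho := (r - Cmod u) / 2); assert (hrho : 0 < rho) by (unfold rho; lra).
assert (hpos : 0 < rho * rho * (rho * (rho * rho)))
  by (apply Rmult_lt_0_compat; [nra|apply Rmult_lt_0_compat; nra]).
assert (cz : forall (w : C) s,
  continuous ((fun s => circle r s - w)%C : R -> C_UniformSpace) s).
{ intros w s; apply continuous_Cminus; [apply continuous_circle|apply continuous_const]. }
assert (c2 : forall (w : C) s,
  continuous ((fun s => (circle r s - w) * (circle r s - w))%C : R -> C_UniformSpace) s).
{ intros w s; apply continuous_Cmult; apply cz. }
destruct (Cmod_continuous_bounded phi 0 (2 * PI)) as [B [hB HB]]; [auto|].
(* The remainder has numerator [RtoC 3 * A - RtoC 2 * h] with |A| <= 2 r and |h| < r, whence
   [6 * r + 2 * r]; the five factors of its denominator are each at least [rho]. *)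
apply (is_Cderive_RIntC (fun w s => phi s / ((circle r s - w) * (circle r s - w)))%C _ u
  0 (2 * PI) rho (B * (6 * r + 2 * r) / (rho * rho * (rho * (rho * rho)))));
  [lra|assumption| | |].
- intros w s hw _; apply continuous_Cdiv; [|auto|apply c2].
  apply Cmult_neq_0; apply circle_minus_neq_0; now apply (Cauchy_kernel_lower_bound r u w s).
- intros s _; apply continuous_Cdiv.
  + repeat apply Cmult_neq_0; now apply circle_minus_neq_0.
  + apply continuous_Cmult; [apply continuous_const|auto].
  + apply continuous_Cmult; [apply cz|apply c2].
- intros w s hw hs.
  destruct (Cauchy_kernel_lower_bound r u w s hu hw) as [h1 h2].
  destruct (Cauchy_kernel_lower_bound r u u s hu) as [h3 _].
  { replace (u - u)%C with (RtoC 0) by ring; rewrite Cmod_0; lra. }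
  fold rho in h1, h3.
  assert (n1 := circle_minus_neq_0 r w s h2); assert (n2 := circle_minus_neq_0 r u s hu).
  assert (hA : Cmod (circle r s - u) <= 2 * r).
  { assert (T := Cmod_triangle (circle r s) (- u)); rewrite Cmod_opp in T.
    rewrite Cmod_circle in T by (generalize (Cmod_ge_0 u); lra).
    unfold Cminus; lra. }
  set (A := (circle r s - u)%C) in *; set (D := (circle r s - w)%C) in *.
  set (h := (w - u)%C) in *.
  replace (phi s / (D * D) - phi s / (A * A) - RtoC 2 * phi s / (A * (A * A)) * h)%C
    with (phi s * (RtoC 3 * A - RtoC 2 * h) / (D * D * (A * (A * A))) * (h * h))%C
    by (replace h with (A - D)%C by (unfold A, D, h; ring_C); field_C; auto).
  rewrite Cmod_mult, (Cmod_mult h h); replace (Cmod h ^ 2) with (Cmod h * Cmod h) by ring.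
  apply Rmult_le_compat_r; [apply Rmult_le_pos; apply Cmod_ge_0|].
  apply Cdiv_Cmod_le; [exact hpos| |].
  + rewrite Cmod_mult; apply Rmult_le_compat; auto using Cmod_ge_0.
    assert (T := Cmod_triangle (RtoC 3 * A) (- (RtoC 2 * h))); rewrite Cmod_opp in T.
    rewrite !Cmod_mult, !Cmod_R, !Rabs_right in T by lra.
    fold (Cminus (RtoC 3 * A) (RtoC 2 * h)) in T.
    assert (Cmod h < r) by (generalize (Cmod_ge_0 u); unfold rho in hw; lra).
    lra.
  + rewrite !Cmod_mult; repeat apply Rmult_le_compat; try lra;
    repeat apply Rmult_le_pos; lra.
Qed.

Lemma Cauchy_density_continuous (f : C -> C) r :
  analytic_on_disk f -> 0 <= r < 1 -> forall s,
  continuous ((fun s => f (circle r s) * (Ci * circle r s))%C : R -> C_UniformSpace) s.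
Proof.
intros Hf hr s; apply continuous_Cmult.
- destruct (Hf (circle r s)) as [l Hl]; [unfold in_disk; rewrite Cmod_circle; lra|].
  apply (continuous_C_comp f (circle r) s l Hl), continuous_circle.
- apply continuous_Cmult; [apply continuous_const|apply continuous_circle].
Qed.

Lemma two_PI_Ci_neq_0 : (RtoC (2 * PI) * Ci)%C <> RtoC 0.
Proof.
apply Cmod_gt_0; rewrite Cmod_mult, Cmod_Ci, Cmod_R, Rabs_right; generalize PI_RGT_0; lra.
Qed.

(** Differentiating Cauchy's formula once writes f' near [z] as an integral with squared kernel, and
    this integral can be differentiated again. *)
Lemma analytic_C_derive (f : C -> C) : analytic_on_disk f -> analytic_on_disk (C_derive f).
Proof.
intros Hf z hz; unfold in_disk in hz.
set (r := (1 + Cmod z) / 2); assert (H0 := Cmod_ge_0 z).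
assert (hr : Cmod z < r) by (unfold r; lra); assert (hr1 : r < 1) by (unfold r; lra).
assert (Hphi := Cauchy_density_continuous f r Hf ltac:(lra)).
set (k := (/ (RtoC (2 * PI) * Ci))%C).
assert (D1 : forall w, Cmod w < r -> is_Cderive f w
  (RIntC (fun s => f (circle r s) * (Ci * circle r s)
            / ((circle r s - w) * (circle r s - w)))%C 0 (2 * PI) * k)%C).
{ intros w hw.
  apply is_Cderive_ext_loc with (f := fun w => (RIntC (fun s => f (circle r s) * (Ci * circle r s)
            / (circle r s - w))%C 0 (2 * PI) * k)%C).
  - exists (r - Cmod w); split; [lra|]; intros y hy.
    rewrite Cauchy_formula; [|auto|auto|generalize (Cmod_reverse_triangle y w); lra].
    unfold k; generalize (RtoC (2 * PI) * Ci)%C, two_PI_Ci_neq_0; intros T hT; field_C; exact hT.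
  - assert (D := is_Cderive_Cauchy_integral _ r w Hphi hw).
    Cderive; ring_C. }
assert (D2 := is_Cderive_Cauchy_integral2 _ r z Hphi hr).
eexists; apply is_Cderive_ext_loc with (f := fun w =>
  (RIntC (fun s => f (circle r s) * (Ci * circle r s)
            / ((circle r s - w) * (circle r s - w)))%C 0 (2 * PI) * k)%C).
- exists (r - Cmod z); split; [lra|]; intros y hy.
  symmetry; apply is_C_derive_unique, D1; generalize (Cmod_reverse_triangle y z); lra.
- Cderive_rec.
Qed.

(** Removable singularity of h(z) / z. Inserting 1 / (s - w) = 1 / s + w / (s (s - w)) in Cauchy's
    formula on |s| = 1/2 gives h(w) = h(0) + w k0(w), where k0 is again a Cauchy integral and hence
    differentiable at 0. Away from 0 the quotient is used directly. *)
Lemma analytic_factor_z (h : C -> C) : analytic_on_disk h -> h (RtoC 0) = RtoC 0 ->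
  exists k, analytic_on_disk k /\ forall z, in_disk z -> h z = (z * k z)%C.
Proof.
intros Hh h0.
assert (Hphi := Cauchy_density_continuous h (1 / 2) Hh ltac:(lra)).
assert (hc : forall s, circle (1 / 2) s <> RtoC 0).
{ intros s; apply Cmod_gt_0; rewrite Cmod_circle; lra. }
set (phi := fun s => (h (circle (1 / 2) s) * Ci)%C).
assert (cphi : forall s, continuous (phi : R -> C_UniformSpace) s).
{ intros s; unfold phi.
  apply (continuous_ext (fun s => h (circle (1 / 2) s) * (Ci * circle (1 / 2) s)
                                  / circle (1 / 2) s)%C).
  - intros t; field_C; auto.
  - apply continuous_Cdiv; auto; apply continuous_circle. }
set (c := (/ (RtoC (2 * PI) * Ci))%C).
set (k0 := fun w => (RIntC (fun s => phi s / (circle (1 / 2) s - w))%C 0 (2 * PI) * c)%C).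
assert (hpi := PI_RGT_0).
assert (E : forall w, Cmod w < 1 / 2 -> h w = (w * k0 w)%C).
{ intros w hw.
  assert (F0 := Cauchy_formula h (1 / 2) 0 Hh ltac:(lra) ltac:(rewrite Cmod_0; lra)).
  rewrite h0 in F0; rewrite (RIntC_ext _ phi) in F0.
  2: lra. 2: intros s _; unfold phi; field_C; auto.
  assert (F1 := Cauchy_formula h (1 / 2) w Hh ltac:(lra) hw).
  rewrite (RIntC_ext _ (fun s => phi s + w * (phi s / (circle (1 / 2) s - w)))%C) in F1.
  2: lra. 2: intros s _; unfold phi; field_C; now apply circle_minus_neq_0.
  assert (i2 : ex_RIntC (fun s => phi s / (circle (1 / 2) s - w))%C 0 (2 * PI)).
  { apply ex_RIntC_continuous; [lra|]; intros s _; apply continuous_Cdiv; auto.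
    - now apply circle_minus_neq_0.
    - apply continuous_Cminus; [apply continuous_circle|apply continuous_const]. }
  rewrite RIntC_plus, RIntC_scal, F0 in F1; auto.
  - unfold k0, c; apply (f_equal (fun x => (x * c)%C)) in F1.
    replace (h w) with (h w * (RtoC (2 * PI) * Ci) * c)%C
      by (unfold c; generalize (RtoC (2 * PI) * Ci)%C, two_PI_Ci_neq_0; intros T hT; field_C; exact hT).
    rewrite <- F1; unfold c; ring_C.
  - apply ex_RIntC_continuous; [lra|auto].
  - apply ex_RIntC_continuous; [lra|]; intros s _; apply continuous_Cmult; [apply continuous_const|].
    apply continuous_Cdiv; auto.
    + now apply circle_minus_neq_0.
    + apply continuous_Cminus; [apply continuous_circle|apply continuous_const]. }
assert (dec : forall w : C, {w = RtoC 0} + {w <> RtoC 0}).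
{ intros w; apply excluded_middle_informative. }
exists (fun w => if dec w then k0 (RtoC 0) else (h w / w)%C); split.
- intros z hz; destruct (dec z) as [->|hz0].
  + assert (D := is_Cderive_Cauchy_integral phi (1 / 2) 0 cphi ltac:(rewrite Cmod_0; lra)).
    eexists; apply is_Cderive_ext_loc with (f := k0).
    * exists (1 / 2); split; [lra|]; intros y hy.
      destruct (dec y) as [->|hy0]; [reflexivity|].
      rewrite (E y); [field_C; auto|].
      replace (y - 0)%C with y in hy by ring_C; assumption.
    * unfold k0; Cderive_rec.
  + destruct (Hh z hz) as [l Hl]; eexists.
    apply is_Cderive_ext_loc with (f := fun w => (h w / w)%C).
    * exists (Cmod z); split; [now apply Cmod_gt_0|]; intros y hy.
      destruct (dec y) as [->|hy0]; [|reflexivity].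
      replace (0 - z)%C with (- z)%C in hy by ring; rewrite Cmod_opp in hy; lra.
    * Cderive_rec; assumption.
- intros z hz; destruct (dec z) as [->|hz0]; [rewrite h0; ring_C|field_C; auto].
Qed.

(** * The maximum modulus principle *)

Lemma analytic_pow (f : C -> C) n : analytic_on_disk f -> analytic_on_disk (fun z => f z ^ n)%C.
Proof.
intros Hf z hz; induction n as [|n [l IH]].
- eexists; apply (is_Cderive_const (RtoC 1)).
- destruct (Hf z hz) as [m Hm]; eexists; exact (is_Cderive_mult _ _ z _ _ Hm IH).
Qed.

Lemma le_of_pow_le (x M K : R) : 0 <= x -> 0 <= M ->
  (forall n, x ^ n <= K * M ^ n) -> x <= M.
Proof.
intros hx hM H; apply Rnot_lt_le; intros h.
destruct (Req_dec M 0) as [->|hM0].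
{ specialize (H 1%nat); simpl in H; lra. }
destruct (Pow_x_infinity (x / M)) with (b := K + 1) as [N HN].
- assert (hq : 1 < x / M).
  { apply Rmult_lt_reg_r with M; [lra|]; unfold Rdiv; rewrite Rmult_assoc, Rinv_l; lra. }
  rewrite Rabs_right; lra.
- specialize (HN N (le_n N)).
  assert (hp : 0 < M ^ N) by (apply pow_lt; lra).
  assert (E : (x / M) ^ N = x ^ N / M ^ N) by (unfold Rdiv; rewrite Rpow_mult_distr, pow_inv; lra).
  rewrite E, Rabs_right in HN.
  + apply Rge_le in HN; apply Rmult_le_compat_r with (r := M ^ N) in HN; [|lra].
    unfold Rdiv in HN; rewrite Rmult_assoc, Rinv_l in HN by lra.
    specialize (H N); nra.
  + apply Rle_ge, Rmult_le_pos; [now apply pow_le|left; now apply Rinv_0_lt_compat].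
Qed.

(* Cauchy's formula for all powers of [f] loses a constant factor that the n-th root kills. *)
Lemma maximum_modulus (f : C -> C) r M (a : C) :
  analytic_on_disk f -> r < 1 -> (forall z, Cmod z = r -> Cmod (f z) <= M) -> Cmod a <= r ->
  Cmod (f a) <= M.
Proof.
intros Hf hr HM ha; destruct (Req_dec (Cmod a) r) as [E|hne]; [auto|].
assert (hr0 := Cmod_ge_0 a); assert (hpi := PI_RGT_0).
assert (hM : 0 <= M).
{ apply Rle_trans with (Cmod (f (circle r 0))); [apply Cmod_ge_0|].
  apply HM, Cmod_circle; lra. }
(* The constant bounds the Cauchy kernel on the circle and does not depend on [n]. *)
apply (le_of_pow_le _ _ (r / (r - Cmod a)) (Cmod_ge_0 _) hM); intros n.
assert (F := Cauchy_formula (fun z => f z ^ n)%C r a (analytic_pow f n Hf) hr ltac:(lra)).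
apply (f_equal Cmod) in F; rewrite !Cmod_mult, Cmod_Ci, Cmod_R, Cmod_pow in F.
rewrite Rabs_right in F by lra.
apply Rmult_le_reg_r with (2 * PI); [lra|].
replace (Cmod (f a) ^ n * (2 * PI)) with (Cmod (f a) ^ n * (2 * PI * 1)) by ring.
rewrite <- F.
replace (r / (r - Cmod a) * M ^ n * (2 * PI))
  with ((2 * PI - 0) * (M ^ n * r / (r - Cmod a))) by (unfold Rdiv; ring).
apply Cmod_RIntC_le; [lra| |].
- apply ex_RIntC_continuous; [lra|]; intros s _.
  apply (Cauchy_integrand_continuous (fun z => f z ^ n)%C); auto; [now apply analytic_pow|lra].
- intros s _; apply Cdiv_Cmod_le; [lra| |].
  + rewrite !Cmod_mult, Cmod_Ci, Cmod_circle, Cmod_pow, Rmult_1_l by lra.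
    apply Rmult_le_compat_r; [lra|]; apply pow_incr; split; [apply Cmod_ge_0|].
    apply HM, Cmod_circle; lra.
  + rewrite <- (Cmod_circle r s) at 1 by lra; apply Cmod_reverse_triangle.
Qed.

(** * Minima on closed disks and Jack's lemma *)

Lemma Cmod_le_Rabs_Re_Im (z : C) : Cmod z <= Rabs (Re z) + Rabs (Im z).
Proof.
destruct z as [p q]; replace ((p, q) : C) with (RtoC p + Ci * RtoC q)%C at 1
  by (unfold Ci, RtoC, Cplus, Cmult; simpl; f_equal; ring).
eapply Rle_trans; [apply Cmod_triangle|]; rewrite Cmod_mult, Cmod_Ci, !Cmod_R; simpl; lra.
Qed.

(** Compactness in the form: a property that holds locally with some gauge, and persists when the
    gauge shrinks, holds on the whole disk with one gauge. *)
Lemma closed_disk_compact (P : C -> R -> Prop) r :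
  0 <= r ->
  (forall y d d', P y d -> 0 < d' <= d -> P y d') ->
  (forall p, Cmod p <= r -> exists d, 0 < d /\
     forall y, Cmod y <= r -> Cmod (y - p) < d -> P y d) ->
  exists d, 0 < d /\ forall y, Cmod y <= r -> P y d.
Proof.
intros hr Hmon Hloc.
assert (H : forall u v : R, exists d : posreal, forall y, Cmod y <= r ->
  Rabs (Re y - u) < d -> Rabs (Im y - v) < d -> P y d).
{ intros u v; set (p := (u, v) : C).
  assert (D : forall y e, Rabs (Re y - u) < e / 2 -> Rabs (Im y - v) < e / 2 -> Cmod (y - p) < e).
  { intros [y1 y2] e h1 h2; eapply Rle_lt_trans; [apply Cmod_le_Rabs_Re_Im|].
    simpl in *; unfold Rminus in *; lra. }
  (* Compactness is applied to the surrounding square, so points outside the disk need a gauge as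
     well; theirs is too small to reach the disk, which makes the claim vacuous. *)
  destruct (Rle_dec (Cmod p) r) as [hp|hp].
  - destruct (Hloc p hp) as [d [hd Hd]].
    assert (h : 0 < d / 2) by lra; exists (mkposreal _ h); intros y hy h1 h2; simpl in *.
    apply (Hmon y d); [|lra]; apply Hd; auto.
  - assert (h : 0 < (Cmod p - r) / 2) by lra.
    exists (mkposreal _ h); intros y hy h1 h2; simpl in *; exfalso.
    specialize (D y (Cmod p - r) h1 h2); generalize (Cmod_reverse_triangle p y).
    rewrite Cmod_minus_sym; lra. }
set (delta := fun u v => proj1_sig (constructive_indefinite_description _ (H u v))).
assert (Hdelta : forall u v y, Cmod y <= r ->
  Rabs (Re y - u) < delta u v -> Rabs (Im y - v) < delta u v -> P y (delta u v)).
{ intros u v; exact (proj2_sig (constructive_indefinite_description _ (H u v))). }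
destruct (compactness_value_2d (- r) r (- r) r delta) as [d Hd].
exists d; split; [apply cond_pos|]; intros y hy.
assert (hmax := Rmax_Cmod y).
assert (h1 : Rabs (fst y) <= r) by (generalize (Rmax_l (Rabs (fst y)) (Rabs (snd y))); lra).
assert (h2 : Rabs (snd y) <= r) by (generalize (Rmax_r (Rabs (fst y)) (Rabs (snd y))); lra).
apply Rabs_le_between in h1, h2.
destruct (NNPP _ (Hd (fst y) (snd y) h1 h2)) as (u & v & _ & _ & k1 & k2 & k3).
apply (Hmon y (delta u v)); [|split; [apply cond_pos|assumption]].
apply Hdelta; assumption.
Qed.

(** Compactness is used twice: first to bound [K], where [1 + / d] turns a uniform gauge into a
    bound, and then to keep [K] a fixed distance above an infimum that is supposed not to be
    attained. *)
Lemma closed_disk_min (K : C -> R) r :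
  0 <= r ->
  (forall z, Cmod z <= r -> forall e, 0 < e -> exists d, 0 < d /\
     forall y, Cmod (y - z) < d -> Rabs (K y - K z) < e) ->
  exists z0, Cmod z0 <= r /\ forall z, Cmod z <= r -> K z0 <= K z.
Proof.
intros hr HK.
destruct (closed_disk_compact (fun y d => Rabs (K y) <= 1 + / d) r hr) as [d [hd Hd]].
{ intros y d d' h [h1 h2]; apply Rle_trans with (1 := h), Rplus_le_compat_l.
  now apply Rinv_le_contravar. }
{ intros p hp; destruct (HK p hp 1 Rlt_0_1) as [d [hd Hd]].
  set (A := 1 + Rabs (K p)); assert (hA : 0 < A) by (generalize (Rabs_pos (K p)); unfold A; lra).
  exists (Rmin d (/ A)).
  assert (h0 : 0 < Rmin d (/ A)) by (apply Rmin_glb_lt; [assumption|now apply Rinv_0_lt_compat]).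
  split; [assumption|]; intros y hy hyp.
  specialize (Hd y (Rlt_le_trans _ _ _ hyp (Rmin_l _ _))).
  assert (h1 : A <= / Rmin d (/ A)).
  { rewrite <- (Rinv_inv A) at 1; apply Rinv_le_contravar; [assumption|apply Rmin_r]. }
  assert (T := Rabs_triang (K y - K p) (K p)); replace (K y - K p + K p) with (K y) in T by ring.
  unfold A in *; lra. }
(* [completeness] provides suprema, so the infimum of [K] appears as [- m]. *)
destruct (completeness (fun x => exists z, Cmod z <= r /\ x = - K z)) as [m [Hm1 Hm2]].
{ exists (1 + / d); intros x [z [hz ->]]; specialize (Hd z hz).
  apply Rabs_le_between in Hd; lra. }
{ exists (- K 0); exists 0; rewrite Cmod_0; auto. }
apply NNPP; intros Hno.
assert (Hlt : forall z, Cmod z <= r -> - m < K z).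
{ intros z hz; apply Rnot_le_lt; intros h; apply Hno; exists z; split; [assumption|].
  intros y hy; assert (- K y <= m) by (apply Hm1; exists y; auto); lra. }
destruct (closed_disk_compact (fun y e => - m + e <= K y) r hr) as [e [he He]].
{ intros; lra. }
{ intros p hp; assert (h := Hlt p hp).
  destruct (HK p hp ((K p + m) / 2)) as [b [hb Hb]]; [lra|].
  exists (Rmin b ((K p + m) / 2)); split; [apply Rmin_glb_lt; lra|]; intros y hy hyp.
  specialize (Hb y (Rlt_le_trans _ _ _ hyp (Rmin_l _ _))).
  assert (h2 := Rmin_r b ((K p + m) / 2)).
  apply Rabs_lt_between in Hb; lra. }
assert (m <= m - e); [|lra].
apply Hm2; intros x [z [hz ->]]; specialize (He z hz); lra.
Qed.

(** * Extrema and derivatives of squared moduli; Jack's lemma *)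

Lemma is_derive_eps (f : R -> R) x l : is_derive f x l ->
  forall e, 0 < e -> exists d, 0 < d /\ forall y, Rabs (y - x) < d ->
    Rabs (f y - f x - l * (y - x)) <= e * Rabs (y - x).
Proof.
intros [_ H] e he; destruct (H x (fun P HP => HP) (mkposreal e he)) as [d Hd].
exists d; split; [apply cond_pos|intros y hy]; rewrite (Rmult_comm l); exact (Hd y hy).
Qed.

Lemma is_derive_left_max (f : R -> R) x l d0 : 0 < d0 ->
  is_derive f x l -> (forall y, x - d0 < y < x -> f y <= f x) -> 0 <= l.
Proof.
intros hd0 H Hmax; apply Rnot_lt_le; intros hl.
destruct (is_derive_eps f x l H (- l / 2)) as [d [hd Hd]]; [lra|].
set (h := Rmin d d0 / 2); assert (hm : 0 < Rmin d d0) by now apply Rmin_glb_lt.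
assert (m1 := Rmin_l d d0); assert (m2 := Rmin_r d d0).
specialize (Hd (x - h)); specialize (Hmax (x - h)).
replace (x - h - x) with (- h) in Hd by ring.
rewrite Rabs_Ropp, (Rabs_right h) in Hd by (unfold h; lra).
assert (Hd1 := Hd ltac:(unfold h; lra)); assert (Hm1 := Hmax ltac:(unfold h; lra)).
apply Rabs_le_between in Hd1; assert (0 < h) by (unfold h; lra); nra.
Qed.

Lemma is_derive_max (f : R -> R) x l :
  is_derive f x l -> (forall y, f y <= f x) -> l = 0.
Proof.
intros H Hmax; apply Rle_antisym.
- assert (H1 : is_derive (fun y => f (- y)) (- x) (- l)).
  { replace (- l) with (scal (-1) l) by (unfold scal; simpl; unfold mult; simpl; ring).
    apply (is_derive_comp f (fun y => - y)); [now rewrite Ropp_involutive|].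
    auto_derive; auto. }
  assert (0 <= - l); [|lra].
  apply (is_derive_left_max _ _ _ 1 Rlt_0_1 H1); intros y _; rewrite Ropp_involutive; auto.
- apply (is_derive_left_max f x l 1 Rlt_0_1 H); auto.
Qed.

Lemma is_Pderive_Im (g : R -> C) x l :
  is_Pderive g x l -> is_derive (fun s => Im (g s)) x (Im l).
Proof.
intros H.
assert (H1 := is_Pderive_Re _ _ _ (is_Pderive_comp _ g x _ _ (is_Cderive_affine 0 (- Ci) (g x)) H)).
replace (Im l) with (Re (- Ci * l)%C) by (destruct l; simpl; ring).
refine (is_derive_ext _ _ _ _ _ H1); intros t; destruct (g t); simpl; ring.
Qed.

(** The square of the modulus is differentiable even where [g] vanishes. *)
Lemma is_derive_Cmod2 (g : R -> C) x l :
  is_Pderive g x l -> is_derive (fun s => Cmod (g s) ^ 2) x (2 * Re (Cconj (g x) * l)%C).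
Proof.
intros H; assert (H1 := is_Pderive_Re _ _ _ H); assert (H2 := is_Pderive_Im _ _ _ H).
apply (is_derive_ext (fun s => Re (g s) ^ 2 + Im (g s) ^ 2)).
- intros t; now rewrite Cmod2_alt.
- replace (2 * Re (Cconj (g x) * l)%C)
    with (plus (INR 2 * Re l * Re (g x) ^ 1) (INR 2 * Im l * Im (g x) ^ 1))
    by (unfold plus; destruct (g x), l; simpl; ring).
  apply (is_derive_plus (K:=R_AbsRing) (V:=R_NormedModule)).
  + exact (is_derive_pow (fun s => Re (g s)) 2 x _ H1).
  + exact (is_derive_pow (fun s => Im (g s)) 2 x _ H2).
Qed.

Lemma Cmod_unit_circle (t : R) : Cmod (circle 1 t) = 1.
Proof. apply Cmod_circle; lra. Qed.

Lemma is_derive_Cmod2_tangential (f : C -> C) (z l : C) : is_Cderive f z l ->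
  is_derive (fun t => Cmod (f (z * circle 1 t)%C) ^ 2) 0 (2 * Re (Cconj (f z) * (l * (Ci * z)))%C).
Proof.
intros H; assert (E : (z * circle 1 0)%C = z)
  by (unfold circle; rewrite sin_0, cos_0; destruct z; unfold Cmult; simpl; f_equal; ring).
assert (P : is_Pderive (fun t => z * circle 1 t)%C 0 (Ci * z)%C).
{ refine (is_Pderive_eq _ _ _ _ (is_derive_ext (V:=C_R_NormedModule) _ _ _ _ _
    (is_Pderive_comp (fun w => 0 + z * w)%C (circle 1) 0 _ _
      (is_Cderive_affine 0 z (circle 1 0)) (is_Pderive_circle 1 0))) _).
  - intros t; simpl; ring_C.
  - rewrite <- E at 2; ring_C. }
assert (Q := is_derive_Cmod2 (fun t => f (z * circle 1 t)%C) 0 (l * (Ci * z))%C).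
cbv beta in Q; rewrite E in Q; apply Q, is_Pderive_comp; [now rewrite E|assumption].
Qed.

Lemma is_derive_Cmod2_radial (f : C -> C) (z l : C) s : is_Cderive f (RtoC s * z)%C l ->
  is_derive (fun t => Cmod (f (RtoC t * z)%C) ^ 2) s (2 * Re (Cconj (f (RtoC s * z)) * (l * z))%C).
Proof.
intros H; apply (is_derive_Cmod2 (fun t => f (RtoC t * z)%C) s).
apply is_Pderive_comp; [assumption|].
refine (is_derive_ext (V:=C_R_NormedModule) _ _ s _ _ (is_Pderive_affine 0 z s)).
intros t; simpl; ring_C.
Qed.

(** With [A] the product of the conjugate of w(z0) and z0 w'(z0), the claim is that A / |w(z0)|^2 is
    real and at least 2. Maximality along the circle makes A real. The maximum principle for [phi],
    that is for w / z^2, gives |w(t z0)| <= t^2 |w(z0)|, and differentiating at t = 1 gives the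
    factor 2. *)
Lemma Jack_lemma (w phi : C -> C) (z0 l : C) :
  analytic_on_disk phi -> in_disk z0 ->
  (forall z, in_disk z -> w z = (z * z * phi z)%C) ->
  is_Cderive w z0 l -> w z0 <> RtoC 0 ->
  (forall z, Cmod z <= Cmod z0 -> Cmod (w z) <= Cmod (w z0)) ->
  exists k, 2 <= k /\ (z0 * l)%C = (RtoC k * w z0)%C.
Proof.
intros Hphi hz0 Hw Hl hw0 Hmax; unfold in_disk in hz0.
set (M := Cmod (w z0)) in *; set (r := Cmod z0) in *.
assert (hM : 0 < M) by now apply Cmod_gt_0.
assert (hr : 0 < r).
{ apply Cmod_gt_0; intros E; apply hw0; rewrite Hw, E by assumption; ring. }
assert (hphi : forall z, Cmod z <= r -> Cmod (phi z) <= M / (r * r)).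
{ intros z; apply maximum_modulus; auto; intros y hy.
  apply Rmult_le_reg_l with (r * r); [now apply Rmult_lt_0_compat|].
  replace (r * r * (M / (r * r))) with M by (field; lra).
  specialize (Hmax y ltac:(lra)); rewrite Hw, !Cmod_mult, hy in Hmax; [assumption|].
  unfold in_disk; lra. }
set (A := (Cconj (w z0) * (l * z0))%C).
assert (hre : 2 * M ^ 2 <= Re A).
{ assert (D := is_derive_Cmod2_radial w z0 l 1); rewrite Cmult_1_l in D; specialize (D Hl).
  fold A in D.
  (* This difference is at most 0 for [t < 1] and vanishes at [t = 1], so its derivative at 1 is
     nonnegative. *)
  assert (D4 : is_derive (fun t => Cmod (w (RtoC t * z0)%C) ^ 2 - M ^ 2 * t ^ 4) 1
    (2 * Re A - M ^ 2 * 4)).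
  { apply (is_derive_minus (K:=R_AbsRing) (V:=R_NormedModule) _ (fun t => M ^ 2 * t ^ 4));
      [assumption|]; auto_derive; auto; ring. }
  assert (0 <= 2 * Re A - M ^ 2 * 4); [|lra].
  apply (is_derive_left_max _ _ _ 1 Rlt_0_1 D4); intros y hy.
  rewrite Cmult_1_l; fold M.
  assert (hyz : Cmod (RtoC y * z0) = y * r).
  { rewrite Cmod_mult, Cmod_R, Rabs_right by lra; reflexivity. }
  assert (B : Cmod (w (RtoC y * z0)%C) <= M * y ^ 2).
  { rewrite Hw by (unfold in_disk; rewrite hyz; nra).
    rewrite !Cmod_mult, Cmod_R, Rabs_right by lra; fold r.
    replace (M * y ^ 2) with (y * r * (y * r) * (M / (r * r))) by (field; lra).
    apply Rmult_le_compat_l; [nra|]; apply hphi; rewrite hyz; nra. }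
  assert (B2 : Cmod (w (RtoC y * z0)%C) ^ 2 <= (M * y ^ 2) ^ 2)
    by (apply pow_incr; split; [apply Cmod_ge_0|assumption]).
  replace ((M * y ^ 2) ^ 2) with (M ^ 2 * y ^ 4) in B2 by ring; lra. }
assert (him : Im A = 0).
{ assert (D := is_derive_Cmod2_tangential w z0 l Hl).
  apply is_derive_max in D.
  - replace (Re (Cconj (w z0) * (l * (Ci * z0)))%C) with (- Im A) in D; [lra|].
    replace (Cconj (w z0) * (l * (Ci * z0)))%C with (Ci * A)%C by (unfold A; ring).
    destruct A; simpl; ring.
  - intros y; apply pow_incr; split; [apply Cmod_ge_0|].
    replace (z0 * circle 1 0)%C with z0
      by (unfold circle; rewrite sin_0, cos_0; destruct z0; unfold Cmult; simpl; f_equal; ring).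
    apply Hmax; rewrite Cmod_mult, Cmod_unit_circle; fold r; lra. }
exists (Re A / M ^ 2); split.
- apply Rmult_le_reg_r with (M ^ 2); [now apply pow_lt|].
  unfold Rdiv; rewrite Rmult_assoc, Rinv_l; [lra|apply pow_nonzero; lra].
- assert (E1 : (A * w z0)%C = (RtoC (M ^ 2) * (z0 * l))%C).
  { unfold M; rewrite Cmod2_conj; unfold A; ring. }
  assert (hM2 : RtoC (M ^ 2) <> RtoC 0) by (intros E; apply RtoC_inj in E; nra).
  assert (E2 : A = RtoC (Re A)) by (destruct A; simpl in *; now rewrite him).
  rewrite RtoC_div by (apply pow_nonzero; lra); rewrite <- E2.
  replace (A / RtoC (M ^ 2) * w z0)%C with (A * w z0 / RtoC (M ^ 2))%C by (field; assumption).
  rewrite E1; field; assumption.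
Qed.

Lemma Cmod_continuous_of_analytic (w : C -> C) z : analytic_on_disk w -> in_disk z ->
  forall e, 0 < e -> exists d, 0 < d /\
    forall y, Cmod (y - z) < d -> Rabs (Cmod (w y) - Cmod (w z)) < e.
Proof.
intros Hw hz e he; destruct (Hw z hz) as [l Hl].
destruct (is_Cderive_continuous w z l Hl e he) as [d [hd Hd]].
exists d; split; [assumption|]; intros y hy; specialize (Hd y hy).
assert (h1 := Cmod_reverse_triangle (w y) (w z)).
assert (h2 := Cmod_reverse_triangle (w z) (w y)); rewrite (Cmod_minus_sym (w z)) in h2.
apply Rabs_lt_between; lra.
Qed.

(** Where |w| >= 1 is maximal, X = (1 + k) w / (1 - w) with k >= 2, and Re (w / (1 - w)) <= - 1 / 2
    outside the unit disk, so that Re X <= - 3 / 2. *)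
Lemma Jack_subordination (w phi X : C -> C) :
  analytic_on_disk w -> analytic_on_disk phi ->
  (forall z, in_disk z -> w z = (z * z * phi z)%C) ->
  (forall z, in_disk z -> (w z + z * C_derive w z = (1 - w z) * X z)%C) ->
  (forall z, in_disk z -> - (3 / 2) < Re (X z)) ->
  forall z, in_disk z -> Cmod (w z) < 1.
Proof.
intros Hw Hphi Hfac HX HRe z1 hz1; apply Rnot_le_lt; intros h1.
destruct (closed_disk_min (fun z => - Cmod (w z)) (Cmod z1)) as [z0 [hz0 Hmin]].
{ apply Cmod_ge_0. }
{ intros z hz e he; unfold in_disk in hz1.
  destruct (Cmod_continuous_of_analytic w z Hw) with (e := e) as [d [hd Hd]];
    [unfold in_disk; lra|assumption|].
  exists d; split; [assumption|]; intros y hy; specialize (Hd y hy).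
  replace (- Cmod (w y) - - Cmod (w z)) with (- (Cmod (w y) - Cmod (w z))) by ring.
  now rewrite Rabs_Ropp. }
assert (hD : in_disk z0) by (unfold in_disk in *; lra).
assert (hge : 1 <= Cmod (w z0)) by (specialize (Hmin z1 ltac:(lra)); lra).
destruct (Hw z0 hD) as [l Hl].
destruct (Jack_lemma w phi z0 l) as [k [hk Ek]]; auto.
{ apply Cmod_gt_0; lra. }
{ intros z hz; specialize (Hmin z ltac:(lra)); lra. }
specialize (HX z0 hD); specialize (HRe z0 hD).
rewrite (is_C_derive_unique w z0 l Hl), Ek in HX.
assert (hm : 1 <= Cmod (w z0) ^ 2) by nra; rewrite Cmod2_alt in hm.
destruct (w z0) as [p q], (X z0) as [x y]; simpl in HRe, hm.
unfold Cplus, Cminus, Cplus, Copp, Cmult, RtoC in HX; simpl in HX.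
apply pair_equal_spec in HX; destruct HX as [e1 e2].
assert (e1' : (1 + k) * p = (1 - p) * x + q * y) by lra.
assert (e2' : (1 + k) * q = (1 - p) * y - q * x) by lra.
(* This is the real part of X |1 - w|^2 = (1 + k) w (1 - conj w), so no division by 1 - w is made
   before the case w = 1 is excluded. *)
assert (S1 : x * ((1 - p) ^ 2 + q ^ 2) = (1 + k) * (p - (p ^ 2 + q ^ 2))).
{ replace (x * ((1 - p) ^ 2 + q ^ 2))
    with ((1 - p) * ((1 - p) * x + q * y) - q * ((1 - p) * y - q * x)) by ring.
  rewrite <- e1', <- e2'; ring. }
destruct (Req_dec ((1 - p) ^ 2 + q ^ 2) 0) as [S0|S0].
- assert (p = 1) by nra; assert (q = 0) by nra; subst; lra.
- assert (0 < (1 - p) ^ 2 + q ^ 2) by nra.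
  assert (p - (p ^ 2 + q ^ 2) <= - ((1 - p) ^ 2 + q ^ 2) / 2) by nra.
  nra.
Qed.

(** * The pre-Schwarzian derivative and starlikeness *)

Lemma analytic_is_Cderive (f : C -> C) z : analytic_on_disk f -> in_disk z ->
  is_Cderive f z (C_derive f z).
Proof. intros Hf hz; apply C_derive_correct; auto. Qed.

Lemma analytic_mult (f g : C -> C) : analytic_on_disk f -> analytic_on_disk g ->
  analytic_on_disk (fun z => f z * g z)%C.
Proof. intros Hf Hg z hz; destruct (Hf z hz), (Hg z hz); ex_Cderive. Qed.

Lemma analytic_minus (f g : C -> C) : analytic_on_disk f -> analytic_on_disk g ->
  analytic_on_disk (fun z => f z - g z)%C.
Proof. intros Hf Hg z hz; destruct (Hf z hz), (Hg z hz); ex_Cderive. Qed.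

Lemma analytic_div (f g : C -> C) : analytic_on_disk f -> analytic_on_disk g ->
  (forall z, in_disk z -> g z <> RtoC 0) -> analytic_on_disk (fun z => f z / g z)%C.
Proof. intros Hf Hg H z hz; destruct (Hf z hz), (Hg z hz); ex_Cderive; auto. Qed.

Lemma analytic_id : analytic_on_disk (fun z => z).
Proof. intros z _; ex_Cderive. Qed.

Lemma analytic_const (a : C) : analytic_on_disk (fun _ => a).
Proof. intros z _; ex_Cderive. Qed.

Lemma in_disk_0 : in_disk (RtoC 0).
Proof. unfold in_disk; rewrite Cmod_0; lra. Qed.

(** Recovers the value at 0 of an identity that was obtained by dividing by [z]. *)
Lemma analytic_eq_at_0 (f g : C -> C) : analytic_on_disk f -> analytic_on_disk g ->
  (forall z, in_disk z -> z <> RtoC 0 -> f z = g z) -> f (RtoC 0) = g (RtoC 0).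
Proof.
intros Hf Hg H.
assert (Hh := analytic_minus f g Hf Hg).
enough (E : (f (RtoC 0) - g (RtoC 0))%C = RtoC 0).
{ replace (f (RtoC 0)) with ((f (RtoC 0) - g (RtoC 0)) + g (RtoC 0))%C by ring; rewrite E; ring. }
apply Cmod_eq_0, Rle_antisym; [|apply Cmod_ge_0].
apply le_epsilon; intros e he; rewrite Rplus_0_l.
destruct (Hh _ in_disk_0) as [l Hl].
destruct (is_Cderive_continuous _ _ _ Hl e he) as [d [hd Hd]].
set (t := Rmin (d / 2) (1 / 2)).
assert (ht : 0 < t) by (apply Rmin_glb_lt; lra).
assert (t1 := Rmin_l (d / 2) (1 / 2)); assert (t2 := Rmin_r (d / 2) (1 / 2)); fold t in t1, t2.
assert (mt : Cmod (RtoC t) = t) by (rewrite Cmod_R, Rabs_right; lra).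
specialize (Hd (RtoC t)); replace (RtoC t - RtoC 0)%C with (RtoC t) in Hd by ring.
rewrite mt in Hd; specialize (Hd ltac:(lra)).
rewrite (H (RtoC t)) in Hd; [|unfold in_disk; lra|intros E; apply RtoC_inj in E; lra].
replace (g (RtoC t) - g (RtoC t) - (f (RtoC 0) - g (RtoC 0)))%C
  with (- (f (RtoC 0) - g (RtoC 0)))%C in Hd by ring.
rewrite Cmod_opp in Hd; lra.
Qed.

(* The hypothesis says that [X = c * w / (1 - w)] for some [w] with [|w| <= rho]. *)
Lemma Cmod_le_shift_bounds c rho (X : C) : 0 < c -> 0 <= rho < 1 ->
  Cmod X <= rho * Cmod (X + RtoC c) ->
  - (c * rho / (1 + rho)) <= Re X <= c * rho / (1 - rho).
Proof.
intros hc hrho H.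
assert (H2 : Cmod X ^ 2 <= (rho * Cmod (X + RtoC c)) ^ 2)
  by (apply pow_incr; split; [apply Cmod_ge_0|assumption]).
rewrite Rpow_mult_distr, !Cmod2_alt in H2; destruct X as [x y]; simpl in *.
(* The hypothesis on [X] describes a disk symmetric about the real axis; the two bounds are the
   endpoints of its real diameter, and [y] only contributes a nonnegative term. *)
assert (K : (x - c * rho / (1 - rho)) * (x + c * rho / (1 + rho)) <= 0).
{ apply Rmult_le_reg_l with ((1 - rho) * (1 + rho)); [nra|].
  replace ((1 - rho) * (1 + rho) * ((x - c * rho / (1 - rho)) * (x + c * rho / (1 + rho))))
    with (((1 - rho) * x - c * rho) * ((1 + rho) * x + c * rho)) by (field; lra).
  rewrite Rmult_0_r.
  assert (0 <= (1 - rho ^ 2) * y ^ 2) by (apply Rmult_le_pos; nra); nra. }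
assert (p1 : 0 <= c * rho / (1 - rho))
  by (apply Rmult_le_pos; [nra|left; apply Rinv_0_lt_compat; lra]).
assert (p2 : 0 <= c * rho / (1 + rho))
  by (apply Rmult_le_pos; [nra|left; apply Rinv_0_lt_compat; lra]).
split; nra.
Qed.

Section ClassF0.
Context (c : R) (f : C -> C) (hc : 0 < c <= 3) (Hf : class_F0 c f).

Let f1 := C_derive f.
Let f2 := C_derive (C_derive f).

Lemma F0_analytic : analytic_on_disk f.
Proof. apply Hf. Qed.

Lemma F0_analytic1 : analytic_on_disk f1.
Proof. apply analytic_C_derive, F0_analytic. Qed.

Lemma F0_analytic2 : analytic_on_disk f2.
Proof. apply analytic_C_derive, F0_analytic1. Qed.

Lemma F0_at_0 : f (RtoC 0) = RtoC 0.
Proof. apply Hf. Qed.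

Lemma F0_derive_at_0 : f1 (RtoC 0) = RtoC 1.
Proof. apply Hf. Qed.

Lemma F0_derive_neq_0 z : in_disk z -> f1 z <> RtoC 0.
Proof. apply Hf. Qed.

Lemma F0_Re z : in_disk z -> - (c / 2) < Re (z * f2 z / f1 z)%C.
Proof.
intros hz; destruct Hf as [[_ [_ H]] _]; specialize (H z hz).
fold f2 in H; fold f1 in H; destruct (z * f2 z / f1 z)%C; simpl in *; lra.
Qed.

Lemma F0_second_factor : exists u, analytic_on_disk u /\ forall z, in_disk z -> f2 z = (z * u z)%C.
Proof. apply analytic_factor_z; [apply F0_analytic2|apply Hf]. Qed.

Lemma F0_pre_Schwarzian_bounds z : in_disk z ->
  - (c * Cmod z ^ 2 / (1 + Cmod z ^ 2)) <= Re (z * f2 z / f1 z)%C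
    <= c * Cmod z ^ 2 / (1 - Cmod z ^ 2).
Proof.
intros hz; destruct F0_second_factor as [u [Hu Eu]].
set (X := fun z => (z * z * (u z / f1 z))%C).
assert (EX : forall z, in_disk z -> (z * f2 z / f1 z)%C = X z).
{ intros y hy; unfold X; rewrite Eu by assumption; field; now apply F0_derive_neq_0. }
assert (HX : analytic_on_disk X).
{ apply analytic_mult; [apply analytic_mult; apply analytic_id|].
  apply analytic_div; [assumption|apply F0_analytic1|apply F0_derive_neq_0]. }
(* The half-plane Re X > - c / 2 is bounded by the perpendicular bisector of the segment from - c to
   0. *)
assert (Hlt : forall y, in_disk y -> Cmod (X y) < Cmod (X y + RtoC c)).
{ intros y hy; assert (H := F0_Re y hy); rewrite EX in H by assumption.
  apply Rsqr_incrst_0; [|apply Cmod_ge_0|apply Cmod_ge_0].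
  rewrite !Rsqr_pow2, !Cmod2_alt; destruct (X y); simpl in *; nra. }
assert (Hnz : forall y, in_disk y -> (X y + RtoC c)%C <> RtoC 0).
{ intros y hy; apply Cmod_gt_0; generalize (Cmod_ge_0 (X y)) (Hlt y hy); lra. }
(* This is X / (z^2 (X + c)) with the double zero of X already divided out; the sum is written as a
   difference for [analytic_minus]. *)
set (phi := fun z => (u z / f1 z / (X z - (- RtoC c)))%C).
assert (Hphi : analytic_on_disk phi).
{ apply analytic_div.
  - apply analytic_div; [assumption|apply F0_analytic1|apply F0_derive_neq_0].
  - apply analytic_minus; [assumption|apply analytic_const].
  - intros y hy; replace (X y - - RtoC c)%C with (X y + RtoC c)%C by ring; auto. }
assert (Ephi : forall y, in_disk y -> X y = (y * y * phi y * (X y + RtoC c))%C).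
{ intros y hy; unfold phi; replace (X y - - RtoC c)%C with (X y + RtoC c)%C by ring.
  unfold X at 1; field; split; [now apply F0_derive_neq_0|auto]. }
assert (Hsup : forall R y, Cmod z <= R < 1 -> 0 < R -> Cmod y = R -> Cmod (phi y) <= / (R * R)).
{ intros R y hR hR0 hy.
  assert (hyD : in_disk y) by (unfold in_disk; lra).
  assert (E := f_equal Cmod (Ephi y hyD)); rewrite !Cmod_mult, hy in E.
  assert (L := Hlt y hyD); assert (P0 := Cmod_ge_0 (X y)).
  apply Rmult_le_reg_l with (R * R); [now apply Rmult_lt_0_compat|].
  rewrite Rinv_r by nra.
  apply Rmult_le_reg_r with (Cmod (X y + RtoC c)); [lra|]; lra. }
assert (H1 : Cmod (phi z) <= 1).
{ unfold in_disk in hz; assert (hz0 := Cmod_ge_0 z).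
  apply Rnot_lt_le; intros h.
  set (m := Cmod (phi z)) in *.
  (* Schwarz's lemma by letting the radius tend to 1. If [m > 1], this radius gives m R^2 >= (m + 1)
     / 2 > 1, against the bound / (R * R) for [phi]. *)
  set (R := Rmax ((1 + Cmod z) / 2) (1 - (m - 1) / (4 * m))).
  assert (hq : 0 < (m - 1) / (4 * m)) by (apply Rdiv_lt_0_compat; lra).
  assert (R1 : (1 + Cmod z) / 2 <= R) by apply Rmax_l.
  assert (R2 : 1 - (m - 1) / (4 * m) <= R) by apply Rmax_r.
  assert (R3 : R < 1) by (apply Rmax_lub_lt; lra).
  assert (hm : m <= / (R * R)).
  { apply (maximum_modulus phi R); auto; [|lra]; intros y; apply Hsup; lra. }
  apply Rmult_le_compat_r with (r := R * R) in hm; [|nra].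
  rewrite Rinv_l in hm by nra.
  assert (m * ((m - 1) / (4 * m)) = (m - 1) / 4) by (field; lra).
  assert (1 - 2 * ((m - 1) / (4 * m)) <= R * R) by nra.
  nra. }
rewrite EX by assumption; apply Cmod_le_shift_bounds; [lra| |].
- unfold in_disk in hz; generalize (Cmod_ge_0 z); split; nra.
- rewrite (Ephi z hz) at 1; rewrite !Cmod_mult; simpl; rewrite Rmult_1_r.
  apply Rmult_le_compat_r; [apply Cmod_ge_0|].
  rewrite <- (Rmult_1_r (Cmod z * Cmod z)) at 2.
  apply Rmult_le_compat_l; [|assumption]; apply Rmult_le_pos; apply Cmod_ge_0.
Qed.

(* [w = 1 - f / (z f')] satisfies [w + z w' = (1 - w) z f'' / f'], and vanishes to second order. *)
Lemma F0_starlike z : in_disk z ->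
  exists w, Cmod w < 1 /\ f z = (z * f1 z * (1 - w))%C.
Proof.
intros hz; destruct F0_second_factor as [u [Hu Eu]].
assert (HB : analytic_on_disk (fun z => z - f z / f1 z)%C).
{ apply analytic_minus; [apply analytic_id|].
  apply analytic_div; [apply F0_analytic|apply F0_analytic1|apply F0_derive_neq_0]. }
(* Factoring z - f / f' instead of forming f / (z f') gives [w] a correct value at 0. *)
destruct (analytic_factor_z _ HB) as [w [Hw Ew]].
{ rewrite F0_at_0, F0_derive_at_0; field; intros E; apply RtoC_inj in E; lra. }
assert (Efw : forall y, in_disk y -> f y = (y * f1 y * (1 - w y))%C).
{ intros y hy; replace (y * f1 y * (1 - w y))%C with (f1 y * (y - y * w y))%C by ring.
  rewrite <- Ew by assumption; field; now apply F0_derive_neq_0. }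
set (dw := C_derive w).
assert (Edw : forall y, in_disk y -> (w y + y * dw y = f y * f2 y / (f1 y * f1 y))%C).
{ intros y hy; assert (N := F0_derive_neq_0 y hy).
  assert (Dw := analytic_is_Cderive w y Hw hy); fold dw in Dw.
  assert (Df := analytic_is_Cderive f y F0_analytic hy); fold f1 in Df.
  assert (Df1 := analytic_is_Cderive f1 y F0_analytic1 hy); change (C_derive f1 y) with (f2 y) in Df1.
  assert (D1 : is_Cderive (fun z => z - f z / f1 z)%C y (f y * f2 y / (f1 y * f1 y))%C).
  { Cderive; [assumption|]; field; assumption. }
  assert (D2 : is_Cderive (fun z => z - f z / f1 z)%C y (w y + y * dw y)%C).
  { apply is_Cderive_ext_loc with (f := fun z => (z * w z)%C).
    - unfold in_disk in hy; exists (1 - Cmod y); split; [lra|]; intros v hv.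
      symmetry; apply Ew; unfold in_disk; generalize (Cmod_reverse_triangle v y); lra.
    - Cderive; ring. }
  rewrite <- (is_C_derive_unique _ _ _ D1); symmetry; now apply is_C_derive_unique. }
assert (w0 : w (RtoC 0) = RtoC 0).
{ assert (E := Edw _ in_disk_0); rewrite F0_at_0, F0_derive_at_0 in E.
  replace (w (RtoC 0)) with (w (RtoC 0) + RtoC 0 * dw (RtoC 0))%C by ring; rewrite E.
  field; intros H; apply RtoC_inj in H; lra. }
destruct (analytic_factor_z w Hw w0) as [psi [Hpsi Epsi]].
set (dpsi := C_derive psi).
assert (Edpsi : forall y, in_disk y -> dw y = (psi y + y * dpsi y)%C).
{ intros y hy; assert (D := analytic_is_Cderive psi y Hpsi hy); fold dpsi in D.
  apply is_C_derive_unique.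
  apply is_Cderive_ext_loc with (f := fun z => (z * psi z)%C).
  - unfold in_disk in hy; exists (1 - Cmod y); split; [lra|]; intros v hv.
    symmetry; apply Epsi; unfold in_disk; generalize (Cmod_reverse_triangle v y); lra.
  - Cderive; ring. }
destruct (analytic_factor_z f F0_analytic F0_at_0) as [g [Hg Eg]].
assert (two : RtoC 2 <> RtoC 0) by (intros E; apply RtoC_inj in E; lra).
(* With w = z psi, f = z g and f'' = z u, the equation for w + z w' becomes, after division by z, 2
   psi + z psi' = z g u / f'^2, whose right side vanishes at 0. The factor z on the right comes from
   f''(0) = 0. *)
assert (psi0 : psi (RtoC 0) = RtoC 0).
{ rewrite (analytic_eq_at_0 psi (fun z => z * (g z * u z / (f1 z * f1 z) - dpsi z) / RtoC 2)%C).
  - field; repeat split; auto; rewrite F0_derive_at_0; intros H; apply RtoC_inj in H; lra.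
  - assumption.
  - apply analytic_div; [|apply analytic_const|auto].
    apply analytic_mult; [apply analytic_id|].
    apply analytic_minus; [|now apply analytic_C_derive].
    apply analytic_div; [now apply analytic_mult|apply analytic_mult; apply F0_analytic1|].
    intros y hy; apply Cmult_neq_0; now apply F0_derive_neq_0.
  - intros y hy hy0; assert (N := F0_derive_neq_0 y hy); assert (E := Edw y hy).
    rewrite Epsi, Edpsi, Eg, Eu in E by assumption.
    assert (E' : (RtoC 2 * psi y + y * dpsi y)%C = (y * (g y * u y / (f1 y * f1 y)))%C).
    { apply (f_equal (fun x => (x / y)%C)) in E.
      replace (y * psi y + y * (psi y + y * dpsi y))%C
        with (y * (RtoC 2 * psi y + y * dpsi y))%C in E by ring.
      replace (y * (RtoC 2 * psi y + y * dpsi y) / y)%C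
        with (RtoC 2 * psi y + y * dpsi y)%C in E by (field; auto).
      rewrite E; field; auto. }
    replace (psi y) with ((RtoC 2 * psi y + y * dpsi y - y * dpsi y) / RtoC 2)%C by (field; auto).
    rewrite E'; field; auto. }
destruct (analytic_factor_z psi Hpsi psi0) as [phi [Hphi Ephi]].
exists (w z); split; [|now apply Efw].
apply (Jack_subordination w phi (fun y => y * f2 y / f1 y)%C); auto.
- intros y hy; rewrite Epsi, Ephi by assumption; ring.
- intros y hy; fold dw; rewrite Edw, (Efw y hy) by assumption; field; now apply F0_derive_neq_0.
- intros y hy; generalize (F0_Re y hy); lra.
Qed.
End ClassF0.

(** * Distortion and growth *)

Lemma le_of_derive_nonneg (h dh : R -> R) :
  (forall t, 0 <= t <= 1 -> is_derive h t (dh t)) ->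
  (forall t, 0 <= t <= 1 -> 0 <= dh t) -> h 0 <= h 1.
Proof.
intros H1 H2; destruct (MVT_gen h 0 1 dh) as [x [hx E]].
- intros x; rewrite Rmin_left, Rmax_right by lra; intros hx; apply H1; lra.
- intros x; rewrite Rmin_left, Rmax_right by lra; intros hx.
  apply continuity_pt_filterlim, (ex_derive_continuous (V:=R_NormedModule)).
  now exists (dh x); apply H1.
- rewrite Rmin_left, Rmax_right in hx by lra; specialize (H2 x hx); lra.
Qed.

(** The interval extends below 0 so that the primitive has a two-sided derivative at the starting
    point of the ray. *)
Lemma is_derive_RInt_open_unit (h : R -> R) : (forall t, -1 < t < 1 -> continuous h t) ->
  forall x, -1 < x < 1 -> is_derive (fun x => RInt h 0 x) x (h x).
Proof.
intros Hh x hx; apply (is_derive_RInt (V:=R_NormedModule) h _ 0 x); [|auto].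
assert (hd : 0 < Rmin (1 - x) (1 + x)) by (apply Rmin_glb_lt; lra).
exists (mkposreal _ hd); intros y hy; change (Rabs (y - x) < Rmin (1 - x) (1 + x)) in hy.
apply (RInt_correct (V:=R_CompleteNormedModule)), (ex_RInt_continuous (V:=R_CompleteNormedModule)).
assert (y1 := Rlt_le_trans _ _ _ hy (Rmin_l _ _)).
assert (y2 := Rlt_le_trans _ _ _ hy (Rmin_r _ _)).
apply Rabs_lt_between in y1, y2.
intros t ht; apply Hh; revert ht; unfold Rmin, Rmax; destruct (Rle_dec 0 y); lra.
Qed.

Lemma continuous_inv_Rpower_plus a t : continuous (fun t => 1 / Rpower (1 + t ^ 2) a) t.
Proof.
apply (ex_derive_continuous (V:=R_NormedModule)); unfold Rpower.
auto_derive; repeat split; [nra|generalize (exp_pos (a * ln (1 + t * (t * 1)))); lra].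
Qed.

Lemma continuous_inv_Rpower_minus a t : -1 < t < 1 ->
  continuous (fun t => 1 / Rpower (1 - t ^ 2) a) t.
Proof.
intros ht; apply (ex_derive_continuous (V:=R_NormedModule)); unfold Rpower.
auto_derive; repeat split; [nra|].
match goal with |- exp ?x <> 0 => generalize (exp_pos x) end; lra.
Qed.

Lemma Re_Cconj_mult_div (a b : C) : a <> RtoC 0 ->
  Re (Cconj a * b)%C = Cmod a ^ 2 * Re (b / a)%C.
Proof.
intros ha; assert (E : (Cconj a * b)%C = (RtoC (Cmod a ^ 2) * (b / a))%C).
{ rewrite Cmod2_conj; field; assumption. }
rewrite E; destruct (b / a)%C; simpl; ring.
Qed.

Lemma Cmod_scal_nonneg t (z : C) : 0 <= t -> Cmod (RtoC t * z) = t * Cmod z.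
Proof. intros ht; rewrite Cmod_mult, Cmod_R, Rabs_right; lra. Qed.

Section Growth.
Context (c : R) (f : C -> C) (hc : 0 < c <= 3) (Hf : class_F0 c f).

Let f1 := C_derive f.
Let f2 := C_derive (C_derive f).

(** The real logarithm of |f'|^2 replaces a branch of log f', which would have to be constructed. *)
Lemma is_derive_ln_Cmod2_F0 z t : in_disk z -> 0 <= t <= 1 ->
  is_derive (fun t => ln (Cmod (f1 (RtoC t * z)%C) ^ 2)) t
    (2 * Re (z * f2 (RtoC t * z) / f1 (RtoC t * z))%C).
Proof.
intros hz ht; assert (hD := in_disk_scal z t hz ht).
assert (N := F0_derive_neq_0 c f Hf _ hD); fold f1 in N.
assert (hp : 0 < Cmod (f1 (RtoC t * z)%C) ^ 2) by (apply pow_lt; now apply Cmod_gt_0).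
assert (D : is_derive (fun t => Cmod (f1 (RtoC t * z)%C) ^ 2) t
  (2 * Re (Cconj (f1 (RtoC t * z)) * (z * f2 (RtoC t * z)))%C)).
{ rewrite (Cmult_comm z); exact (is_derive_Cmod2_radial f1 z _ t
    (analytic_is_Cderive f1 _ (F0_analytic1 c f Hf) hD)). }
assert (D2 := is_derive_comp ln _ t _ _ (is_derive_ln _ hp) D).
rewrite Re_Cconj_mult_div in D2 by assumption.
refine (eq_rect _ (fun l => is_derive _ t l) D2 _ _).
clear - hp; revert hp; generalize (Cmod (f1 (RtoC t * z)) ^ 2).
generalize (Re (z * f2 (RtoC t * z) / f1 (RtoC t * z))%C); intros q p hp.
change (2 * (p * q) * / p = 2 * q); field; lra.
Qed.

Lemma F0_radial_bounds z t : in_disk z -> 0 <= t <= 1 ->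
  - (c * t * Cmod z ^ 2 / (1 + t ^ 2 * Cmod z ^ 2))
    <= Re (z * f2 (RtoC t * z) / f1 (RtoC t * z))%C
    <= c * t * Cmod z ^ 2 / (1 - t ^ 2 * Cmod z ^ 2).
Proof.
intros hz ht; assert (hD := in_disk_scal z t hz ht).
assert (N := F0_derive_neq_0 c f Hf _ hD); fold f1 in N.
(* The bounds at [t * z] are [t] times the claim; at [t = 0] the claim is f''(0) = 0. *)
destruct (Req_dec t 0) as [->|ht0].
- assert (E0 : (RtoC 0 * z)%C = RtoC 0) by ring; rewrite E0 in *; unfold f2; rewrite (proj2 Hf).
  replace (z * RtoC 0 / f1 (RtoC 0))%C with (RtoC 0) by (field; exact N).
  simpl; unfold Rdiv; rewrite Rmult_0_r, !Rmult_0_l; lra.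
- assert (B := F0_pre_Schwarzian_bounds c f hc Hf _ hD); fold f2 in B; fold f1 in B.
  rewrite Cmod_scal_nonneg, Rpow_mult_distr in B by lra.
  assert (htC : RtoC t <> RtoC 0) by (intros E; apply RtoC_inj in E; lra).
  replace (RtoC t * z * f2 (RtoC t * z) / f1 (RtoC t * z))%C
    with (RtoC t * (z * f2 (RtoC t * z) / f1 (RtoC t * z)))%C in B by (field; assumption).
  set (Y := (z * f2 (RtoC t * z) / f1 (RtoC t * z))%C) in *.
  replace (Re (RtoC t * Y)%C) with (t * Re Y) in B by (destruct Y; simpl; ring).
  assert (hr : 0 <= t ^ 2 * Cmod z ^ 2 < 1).
  { unfold in_disk in hz; assert (0 <= Cmod z ^ 2 < 1) by (generalize (Cmod_ge_0 z); split; nra).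
    assert (0 <= t ^ 2 <= 1) by (split; nra); split; nra. }
  replace (c * (t ^ 2 * Cmod z ^ 2) / (1 + t ^ 2 * Cmod z ^ 2))
    with (t * (c * t * Cmod z ^ 2 / (1 + t ^ 2 * Cmod z ^ 2))) in B by (field; lra).
  replace (c * (t ^ 2 * Cmod z ^ 2) / (1 - t ^ 2 * Cmod z ^ 2))
    with (t * (c * t * Cmod z ^ 2 / (1 - t ^ 2 * Cmod z ^ 2))) in B by (field; lra).
  rewrite Ropp_mult_distr_r in B.
  split; apply Rmult_le_reg_l with t; lra.
Qed.

Lemma inv_Rpower_half_le x y : 0 < x -> - (c * ln y) <= ln (x ^ 2) -> 1 / Rpower y (c / 2) <= x.
Proof.
intros hx H; simpl in H; rewrite Rmult_1_r, ln_mult in H by assumption.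
unfold Rpower, Rdiv; rewrite Rmult_1_l, <- exp_Ropp, <- (exp_ln x) by assumption.
destruct (Rle_lt_or_eq_dec (- (c * / 2 * ln y)) (ln x)) as [h| ->];
  [lra|left; now apply exp_increasing|right; reflexivity].
Qed.

Lemma le_inv_Rpower_half x y : 0 < x -> ln (x ^ 2) <= - (c * ln y) -> x <= 1 / Rpower y (c / 2).
Proof.
intros hx H; simpl in H; rewrite Rmult_1_r, ln_mult in H by assumption.
unfold Rpower, Rdiv; rewrite Rmult_1_l, <- exp_Ropp, <- (exp_ln x) by assumption.
destruct (Rle_lt_or_eq_dec (ln x) (- (c * / 2 * ln y))) as [h| ->];
  [lra|left; now apply exp_increasing|right; reflexivity].
Qed.

Lemma F0_distortion z : in_disk z ->
  1 / Rpower (1 + Cmod z ^ 2) (c / 2) <= Cmod (f1 z) <= 1 / Rpower (1 - Cmod z ^ 2) (c / 2).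
Proof.
intros hz; assert (hp : 0 < Cmod (f1 z)) by (apply Cmod_gt_0, (F0_derive_neq_0 c f Hf z hz)).
assert (hr : 0 <= Cmod z ^ 2 < 1)
  by (unfold in_disk in hz; generalize (Cmod_ge_0 z); split; nra).
assert (h0 : ln (Cmod (f1 (RtoC 0 * z)%C) ^ 2) = 0).
{ replace (RtoC 0 * z)%C with (RtoC 0) by ring; unfold f1.
  rewrite (F0_derive_at_0 c f Hf), Cmod_1, pow1; apply ln_1. }
set (r2 := Cmod z ^ 2) in *.
split.
- apply inv_Rpower_half_le; [assumption|].
  (* The logarithm of the ratio of |f'|^2 to the claimed bound is monotone along the ray and starts
     at 0. *)
  assert (L := le_of_derive_nonneg
    (fun t => ln (Cmod (f1 (RtoC t * z)%C) ^ 2) + c * ln (1 + t ^ 2 * r2))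
    (fun t => 2 * Re (z * f2 (RtoC t * z) / f1 (RtoC t * z))%C + c * (2 * t * r2 / (1 + t ^ 2 * r2)))).
  cbv beta in L; rewrite h0, Cmult_1_l in L.
  replace (1 + 0 ^ 2 * r2) with 1 in L by ring; replace (1 + 1 ^ 2 * r2) with (1 + r2) in L by ring.
  rewrite ln_1 in L; enough (0 + c * 0 <= ln (Cmod (f1 z) ^ 2) + c * ln (1 + r2)) by lra.
  apply L.
  + intros t ht; apply (is_derive_plus (K:=R_AbsRing) (V:=R_NormedModule)).
    * now apply is_derive_ln_Cmod2_F0.
    * assert (0 <= t ^ 2 * r2) by (apply Rmult_le_pos; [apply pow2_ge_0|lra]).
      auto_derive; [simpl in *; lra|]; field; simpl in *; lra.
  + intros t ht; destruct (F0_radial_bounds z t hz ht) as [B _]; fold r2 in B.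
    assert (0 <= t ^ 2 * r2) by (apply Rmult_le_pos; [apply pow2_ge_0|lra]).
    replace (c * (2 * t * r2 / (1 + t ^ 2 * r2))) with (2 * (c * t * r2 / (1 + t ^ 2 * r2)))
      by (field; lra); lra.
- apply le_inv_Rpower_half; [assumption|].
  assert (L := le_of_derive_nonneg
    (fun t => - c * ln (1 - t ^ 2 * r2) - ln (Cmod (f1 (RtoC t * z)%C) ^ 2))
    (fun t => c * (2 * t * r2 / (1 - t ^ 2 * r2)) - 2 * Re (z * f2 (RtoC t * z) / f1 (RtoC t * z))%C)).
  cbv beta in L; rewrite h0, Cmult_1_l in L.
  replace (1 - 0 ^ 2 * r2) with 1 in L by ring; replace (1 - 1 ^ 2 * r2) with (1 - r2) in L by ring.
  rewrite ln_1 in L; enough (- c * 0 - 0 <= - c * ln (1 - r2) - ln (Cmod (f1 z) ^ 2)) by lra.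
  apply L.
  + intros t ht; apply (is_derive_minus (K:=R_AbsRing) (V:=R_NormedModule)).
    * assert (t ^ 2 * r2 < 1) by (assert (0 <= t ^ 2 <= 1) by (split; nra); nra).
      auto_derive; [simpl in *; lra|]; field; simpl in *; lra.
    * now apply is_derive_ln_Cmod2_F0.
  + intros t ht; destruct (F0_radial_bounds z t hz ht) as [_ B]; fold r2 in B.
    assert (t ^ 2 * r2 < 1) by (assert (0 <= t ^ 2 <= 1) by (split; nra); nra).
    replace (c * (2 * t * r2 / (1 - t ^ 2 * r2))) with (2 * (c * t * r2 / (1 - t ^ 2 * r2)))
      by (field; lra); lra.
Qed.

Lemma F0_growth_upper z : in_disk z ->
  Cmod (f z) <= RInt (fun t => 1 / Rpower (1 - t ^ 2) (c / 2)) 0 (Cmod z).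
Proof.
intros hz; set (F := RInt (fun t => 1 / Rpower (1 - t ^ 2) (c / 2)) 0).
(* The rotation [e] turns |f(z)| into the value at t = 1 of the smooth function Re (e f(t z)),
   avoiding |f(t z)| itself, which need not be differentiable at t = 0. *)
assert (He : exists e : C, Cmod e = 1 /\ Re (e * f z)%C = Cmod (f z)).
{ destruct (excluded_middle_informative (f z = RtoC 0)) as [E|E].
  - exists (RtoC 1); rewrite E, Cmod_0, Cmod_1; split; [reflexivity|simpl; ring].
  - assert (hp : 0 < Cmod (f z)) by now apply Cmod_gt_0.
    assert (hpC : RtoC (Cmod (f z)) <> RtoC 0) by (intros K; apply RtoC_inj in K; lra).
    exists (Cconj (f z) / RtoC (Cmod (f z)))%C; split.
    + rewrite Cmod_div, Cmod_conj, Cmod_R, Rabs_right by (auto; lra); field; lra.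
    + replace (Cconj (f z) / RtoC (Cmod (f z)) * f z)%C
        with (f z * Cconj (f z) / RtoC (Cmod (f z)))%C by (field; assumption).
      rewrite <- Cmod2_conj, <- RtoC_div by lra; simpl; field; lra. }
destruct He as [e [he1 he2]].
assert (L := le_of_derive_nonneg (fun t => F (t * Cmod z) - Re (e * f (RtoC t * z))%C)
  (fun t => Cmod z * (1 / Rpower (1 - (t * Cmod z) ^ 2) (c / 2))
            - Re (e * (f1 (RtoC t * z) * z))%C)).
cbv beta in L; rewrite Rmult_0_l, Rmult_1_l, Cmult_1_l, he2 in L.
replace (RtoC 0 * z)%C with (RtoC 0) in L by ring.
rewrite (F0_at_0 c f Hf), Cmult_0_r in L.
assert (E0 : F 0 = 0) by apply (RInt_point (V:=R_CompleteNormedModule)).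
rewrite E0 in L; simpl (Re (RtoC 0)) in L.
enough (0 - 0 <= F (Cmod z) - Cmod (f z)) by lra; apply L; intros t ht.
- assert (hD := in_disk_scal z t hz ht).
  assert (hDr := hD); unfold in_disk in hDr; rewrite Cmod_scal_nonneg in hDr by lra.
  assert (h0 : 0 <= t * Cmod z) by (apply Rmult_le_pos; [lra|apply Cmod_ge_0]).
  apply (is_derive_minus (K:=R_AbsRing) (V:=R_NormedModule)).
  + apply (is_derive_comp F (fun t => t * Cmod z)).
    * apply (is_derive_RInt_open_unit (fun t => 1 / Rpower (1 - t ^ 2) (c / 2))); [|lra].
      intros x hx; now apply continuous_inv_Rpower_minus.
    * auto_derive; auto; ring.
  + apply (is_Pderive_Re (fun t => e * f (RtoC t * z))%C).
    refine (is_Pderive_eq _ _ _ _ (is_Pderive_comp (fun w => e * f w)%C (fun t => RtoC t * z)%C t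
      (e * f1 (RtoC t * z))%C z _ _) _).
    * assert (D := analytic_is_Cderive f _ (F0_analytic c f Hf) hD); fold f1 in D.
      Cderive; ring.
    * refine (is_derive_ext (V:=C_R_NormedModule) _ _ t _ _ (is_Pderive_affine 0 z t)).
      intros u; simpl; ring_C.
    * ring.
- assert (hD := in_disk_scal z t hz ht).
  assert (B := proj2 (F0_distortion _ hD)); rewrite Cmod_scal_nonneg in B by lra.
  assert (T := Rle_trans _ _ _ (Rle_abs _) (re_le_Cmod (e * (f1 (RtoC t * z) * z))%C)).
  rewrite !Cmod_mult, he1, Rmult_1_l, (Rmult_comm (Cmod (f1 _))) in T.
  assert (M := Rmult_le_compat_l _ _ _ (Cmod_ge_0 z) B); lra.
Qed.

(** The minimum may lie on the boundary of the disk: it is compared only with points of its own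
    circle and of the radius leading to it. *)
Lemma F0_growth_lower z : in_disk z ->
  RInt (fun t => 1 / Rpower (1 + t ^ 2) (c / 2)) 0 (Cmod z) <= Cmod (f z).
Proof.
intros hz1; set (F := RInt (fun t => 1 / Rpower (1 + t ^ 2) (c / 2)) 0).
assert (DF : forall x, -1 < x < 1 -> is_derive F x (1 / Rpower (1 + x ^ 2) (c / 2))).
{ apply is_derive_RInt_open_unit; intros t _; apply continuous_inv_Rpower_plus. }
assert (E0 : F 0 = 0) by apply (RInt_point (V:=R_CompleteNormedModule)).
apply le_epsilon; intros e he.
set (K := fun y => Cmod (f y) - F (Cmod y) + e * Cmod y).
destruct (closed_disk_min K (Cmod z) (Cmod_ge_0 z)) as [z0 [hz0 Hmin]].
{ intros y hy e' he'; unfold in_disk in hz1.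
  destruct (Cmod_continuous_of_analytic f y (F0_analytic c f Hf)) with (e := e' / 3)
    as [d1 [hd1 Hd1]]; [unfold in_disk; lra|lra|].
  assert (cF : continuous F (Cmod y)).
  { apply (ex_derive_continuous (V:=R_NormedModule)); eexists; apply DF.
    generalize (Cmod_ge_0 y); lra. }
  assert (he3 : 0 < e' / 3) by lra.
  destruct (cF (fun x => Rabs (x - F (Cmod y)) < e' / 3)) as [d2 Hd2].
  { exists (mkposreal _ he3); intros x hx; exact hx. }
  assert (hd3 : 0 < e' / 3 / e) by now apply Rdiv_lt_0_compat.
  exists (Rmin d1 (Rmin d2 (e' / 3 / e))); split.
  { repeat apply Rmin_glb_lt; auto; apply cond_pos. }
  intros v hv.
  assert (v1 := Rlt_le_trans _ _ _ hv (Rmin_l _ _)).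
  assert (v' := Rlt_le_trans _ _ _ hv (Rmin_r _ _)).
  assert (v2 := Rlt_le_trans _ _ _ v' (Rmin_l _ _)).
  assert (v3 := Rlt_le_trans _ _ _ v' (Rmin_r _ _)).
  assert (hm : Rabs (Cmod v - Cmod y) <= Cmod (v - y)).
  { apply Rabs_le; split; [|apply Cmod_reverse_triangle].
    generalize (Cmod_reverse_triangle y v); rewrite (Cmod_minus_sym y v); lra. }
  assert (k1 := Hd1 v v1); assert (k2 := Hd2 (Cmod v) (Rle_lt_trans _ _ _ hm v2)).
  assert (k3 : Rabs (e * (Cmod v - Cmod y)) < e' / 3).
  { rewrite Rabs_mult, (Rabs_right e) by lra.
    replace (e' / 3) with (e * (e' / 3 / e)) by (field; lra).
    apply Rmult_lt_compat_l; lra. }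
  unfold K; apply Rabs_lt_between in k1, k2, k3; apply Rabs_lt_between; lra. }
(* Since |z| < 1, the perturbation [e * Cmod z] is at most [e]. *)
assert (K0 : 0 <= K z0 -> F (Cmod z) <= Cmod (f z) + e).
{ intros h; specialize (Hmin z (Rle_refl _)); unfold K in Hmin at 2.
  unfold in_disk in hz1; generalize (Cmod_ge_0 z); nra. }
apply K0; destruct (excluded_middle_informative (z0 = RtoC 0)) as [E|Enz].
{ unfold K; rewrite E, (F0_at_0 c f Hf), Cmod_0, E0; lra. }
exfalso; clear K0.
assert (hD : in_disk z0) by (unfold in_disk in *; lra).
set (r := Cmod z0) in *; assert (hr : 0 < r) by now apply Cmod_gt_0.
assert (hr1 : r < 1) by exact hD.
destruct (F0_starlike c f hc Hf z0 hD) as [w [hw Ew]]; fold f1 in Ew.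
assert (N1 := F0_derive_neq_0 c f Hf z0 hD); fold f1 in N1.
assert (D := analytic_is_Cderive f z0 (F0_analytic c f Hf) hD); fold f1 in D.
assert (B := proj1 (F0_distortion z0 hD)); fold r in B; clearbody f1.
(* [Re A] and [- Im A] are half the radial and tangential derivatives of |f|^2. Starlikeness makes
   the former positive and minimality the latter zero, so that Re A = |A|. *)
set (A := (Cconj (f z0) * (f1 z0 * z0))%C).
assert (hA : 0 < Re A).
{ assert (EA : A = (RtoC (Cmod (z0 * f1 z0) ^ 2) * Cconj (1 - w))%C).
  { rewrite Cmod2_conj; unfold A; rewrite Ew, !Cmult_conj; ring. }
  assert (p : 0 < Cmod (z0 * f1 z0) ^ 2)
    by (apply pow_lt, Cmod_gt_0, Cmult_neq_0; assumption).
  assert (hre := Rle_lt_trans _ _ _ (re_le_Cmod w) hw); apply Rabs_lt_between in hre.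
  rewrite EA; revert p; generalize (Cmod (z0 * f1 z0) ^ 2); intros p hp.
  replace (Re (RtoC p * Cconj (1 - w))%C) with (p * (1 - Re w)) by (destruct w; simpl; ring).
  apply Rmult_lt_0_compat; lra. }
assert (him : Im A = 0).
{ assert (T := is_derive_Cmod2_tangential f z0 _ D).
  assert (T' := is_derive_opp _ _ _ T); apply is_derive_max in T'.
  - replace (Re (Cconj (f z0) * (f1 z0 * (Ci * z0)))%C) with (- Im A) in T'.
    + change (- (2 * - Im A) = 0) in T'; lra.
    + replace (Cconj (f z0) * (f1 z0 * (Ci * z0)))%C with (Ci * A)%C by (unfold A; ring).
      destruct A; simpl; ring.
  - intros y; unfold opp; simpl opp; apply Ropp_le_contravar.
    apply pow_incr; split; [apply Cmod_ge_0|].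
    replace (z0 * circle 1 0)%C with z0
      by (unfold circle; rewrite sin_0, cos_0; destruct z0; unfold Cmult; simpl; f_equal; ring).
    assert (Em : Cmod (z0 * circle 1 y) = r) by (rewrite Cmod_mult, Cmod_unit_circle; unfold r; ring).
    specialize (Hmin (z0 * circle 1 y)%C); unfold K in Hmin; rewrite Em in Hmin; fold r in Hmin.
    specialize (Hmin hz0); lra. }
assert (mA : Re A = Cmod (f z0) * (Cmod (f1 z0) * r)).
{ assert (H : Cmod A = Cmod (f z0) * (Cmod (f1 z0) * r))
    by (unfold A; rewrite !Cmod_mult, Cmod_conj; reflexivity).
  rewrite <- H; replace A with (RtoC (Re A)) at 2 by (destruct A; simpl in *; now rewrite him).
  rewrite Cmod_R, Rabs_right; lra. }
assert (hf : 0 < Cmod (f z0)).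
{ destruct (Cmod_ge_0 (f z0)) as [h|h]; [assumption|]; rewrite <- h in mA; lra. }
assert (R1 := is_derive_Cmod2_radial f z0 (f1 z0) 1); rewrite Cmult_1_l in R1; specialize (R1 D).
fold A in R1; clearbody A.
assert (hp : 0 < Cmod (f (RtoC 1 * z0)%C) ^ 2) by (rewrite Cmult_1_l; now apply pow_lt).
assert (R2 := is_derive_sqrt _ _ _ R1 hp); cbv beta in R2.
rewrite Cmult_1_l, sqrt_pow2 in R2 by apply Cmod_ge_0.
assert (R3 : is_derive (fun t => F (t * r) - e * (t * r)) 1
  (r * (1 / Rpower (1 + r ^ 2) (c / 2)) - e * r)).
{ apply (is_derive_minus (K:=R_AbsRing) (V:=R_NormedModule)).
  - apply (is_derive_comp F (fun t => t * r)).
    + rewrite Rmult_1_l; apply DF; lra.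
    + auto_derive; auto; ring.
  - auto_derive; auto; ring. }
(* Minimality makes F(t r) - e t r - |f(t z0)| largest at t = 1 among t <= 1, so F'(r) - e -
   |f'(z0)| >= 0, contrary to |f'(z0)| >= F'(r). *)
assert (R4 := is_derive_minus _ _ _ _ _ R3 R2).
apply is_derive_left_max with (d0 := 1) in R4; [|lra|].
- unfold minus, plus, opp in R4; simpl in R4.
  rewrite mA in R4.
  replace (2 * (Cmod (f z0) * (Cmod (f1 z0) * r)) / (2 * Cmod (f z0)))
    with (r * Cmod (f1 z0)) in R4 by (field; lra).
    simpl in B; set (b := 1 / Rpower (1 + r * (r * 1)) (c / 2)) in *; nra.
- intros t ht; unfold minus, plus, opp; simpl.
  specialize (Hmin (RtoC t * z0)%C); unfold K in Hmin.
  rewrite Cmod_scal_nonneg in Hmin by lra; fold r in Hmin; specialize (Hmin ltac:(nra)).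
  replace (Cmod (f (RtoC t * z0)%C) * (Cmod (f (RtoC t * z0)%C) * 1))
    with (Cmod (f (RtoC t * z0)%C) ^ 2) by ring.
  replace (Cmod (f (RtoC 1 * z0)%C) * (Cmod (f (RtoC 1 * z0)%C) * 1))
    with (Cmod (f z0) ^ 2) by (rewrite Cmult_1_l; ring).
  rewrite !sqrt_pow2 by apply Cmod_ge_0; rewrite Rmult_1_l; lra.
Qed.
End Growth.

(** * Extremal functions *)

Lemma Cexp_neq_0 w : Cexp w <> RtoC 0.
Proof.
intros E; unfold Cexp, RtoC in E; apply pair_equal_spec in E; destruct E as [E1 E2].
generalize (exp_pos (Re w)) (sin2_cos2 (Im w)); unfold Rsqr; intros h1 h2.
apply Rmult_integral in E1, E2; nra.
Qed.

Lemma Cpower_RtoC x a : 0 < x -> Cpower (RtoC x) (RtoC a) = RtoC (Rpower x a).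
Proof.
intros hx; unfold Cpower; rewrite Clog_right_half_plane by exact hx.
unfold Cexp, Rpower, RtoC, Cmult, Re, Im; simpl.
replace (x * (x * 1) + 0 * (0 * 1)) with (x * x) by ring; rewrite sqrt_square by lra.
replace (0 / x) with 0 by (field; lra); rewrite atan_0.
replace (a * 0 + 0 * ln x) with 0 by ring; replace (a * ln x - 0 * 0) with (a * ln x) by ring.
rewrite cos_0, sin_0; f_equal; ring.
Qed.

Section Extremal.
Context (c : R) (lambda : C) (hc : 0 < c) (hl : Cmod lambda = 1).

Let g (z : C) : C := (1 / Cpower (1 - lambda * (z * z)) (RtoC (c / 2)))%C.
(** Written as [g] times its logarithmic derivative, so that [g] cancels in the quotient of the
    class condition. *)
Let dg (z : C) : C := (g z * (RtoC c * lambda * z / (1 - lambda * (z * z))))%C.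

Lemma Cmod_ext_argument z : Cmod (lambda * (z * z)) = Cmod z ^ 2.
Proof. rewrite !Cmod_mult, hl; ring. Qed.

Lemma Re_ext_base z : in_disk z -> 0 < Re (1 - lambda * (z * z))%C.
Proof.
unfold in_disk; intros hz.
assert (h : Cmod (lambda * (z * z)) < 1)
  by (rewrite Cmod_ext_argument; generalize (Cmod_ge_0 z); nra).
assert (H := Rle_lt_trans _ _ _ (re_le_Cmod _) h); apply Rabs_lt_between in H.
destruct (lambda * (z * z))%C; simpl in *; lra.
Qed.

Lemma ext_base_neq_0 z : in_disk z -> (1 - lambda * (z * z))%C <> RtoC 0.
Proof. intros hz E; assert (H := Re_ext_base z hz); rewrite E in H; simpl in H; lra. Qed.

Lemma is_Cderive_ext_density z : in_disk z -> is_Cderive g z (dg z).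
Proof.
intros hz; assert (N := ext_base_neq_0 z hz).
assert (Db : is_Cderive (fun z => 1 - lambda * (z * z))%C z (- (RtoC 2 * lambda * z))%C).
{ Cderive; ring. }
assert (Dl := is_Cderive_comp Clog (fun z => 1 - lambda * (z * z))%C z _ _
  (is_Cderive_Clog _ (Re_ext_base z hz)) Db).
assert (Dm := is_Cderive_mult (fun _ => RtoC (c / 2)) _ z _ _ (is_Cderive_const _ z) Dl).
assert (De := is_Cderive_comp Cexp (fun z => RtoC (c / 2) * Clog (1 - lambda * (z * z)))%C z _ _
  (is_Cderive_Cexp _) Dm).
assert (NE := Cexp_neq_0 (RtoC (c / 2) * Clog (1 - lambda * (z * z)))%C).
refine (is_Cderive_eq _ _ _ _ (is_Cderive_div (fun _ => RtoC 1) _ z _ _ NE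
  (is_Cderive_const _ z) De) _).
unfold dg, g, Cpower; cbv beta; rewrite RtoC_div by lra.
rewrite RtoC_div in NE by lra.
revert NE; generalize (Cexp (RtoC c / RtoC 2 * Clog (1 - lambda * (z * z)))%C); intros e NE.
field; repeat split; auto; intros E; apply RtoC_inj in E; lra.
Qed.

Lemma analytic_ext_density : analytic_on_disk g.
Proof. intros z hz; exists (dg z); now apply is_Cderive_ext_density. Qed.

Lemma C_derive_f_ext z : in_disk z -> C_derive (f_ext c lambda) z = g z.
Proof.
intros hz; apply is_C_derive_unique, (is_Cderive_segment_int g z analytic_ext_density hz).
Qed.

Lemma C_derive2_f_ext z : in_disk z -> C_derive (C_derive (f_ext c lambda)) z = dg z.
Proof.
intros hz; apply is_C_derive_unique.
apply is_Cderive_ext_loc with (f := g); [|now apply is_Cderive_ext_density].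
unfold in_disk in hz; exists (1 - Cmod z); split; [lra|]; intros v hv.
symmetry; apply C_derive_f_ext; unfold in_disk; generalize (Cmod_reverse_triangle v z); lra.
Qed.

Lemma f_ext_at_0 : f_ext c lambda (RtoC 0) = RtoC 0.
Proof.
unfold f_ext, segment_int; rewrite (RIntC_ext _ (fun _ => RtoC 0)).
- rewrite RIntC_const; ring_C.
- lra.
- intros t _; ring_C.
Qed.

Lemma ext_density_neq_0 z : g z <> RtoC 0.
Proof.
unfold g; intros E; apply (Cexp_neq_0 (RtoC (c / 2) * Clog (1 - lambda * (z * z)))%C).
unfold Cpower in E; set (e := Cexp _) in *.
destruct (excluded_middle_informative (e = RtoC 0)) as [h|h]; [assumption|].
exfalso; assert (H : (1 / e * e)%C = RtoC 0) by (rewrite E; ring).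
replace (1 / e * e)%C with (RtoC 1) in H by (field; assumption); apply RtoC_inj in H; lra.
Qed.

Lemma class_F0_f_ext : class_F0 c (f_ext c lambda).
Proof.
split; [split; [split; [|split]|split]|].
- intros z hz; exists (g z); exact (is_Cderive_segment_int g z analytic_ext_density hz).
- apply f_ext_at_0.
- rewrite C_derive_f_ext by apply in_disk_0; unfold g.
  replace (1 - lambda * (RtoC 0 * RtoC 0))%C with (RtoC 1) by ring.
  rewrite Cpower_RtoC by lra; unfold Rpower; rewrite ln_1, Rmult_0_r, exp_0; field.
- intros z hz; rewrite C_derive_f_ext by assumption; apply ext_density_neq_0.
- intros z hz; rewrite C_derive_f_ext, C_derive2_f_ext by assumption; unfold dg.
  assert (N := ext_base_neq_0 z hz); assert (NE := ext_density_neq_0 z).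
  assert (hu : Cmod (lambda * (z * z)) ^ 2 < 1).
  { rewrite Cmod_ext_argument; unfold in_disk in hz.
    assert (0 <= Cmod z ^ 2 < 1) by (generalize (Cmod_ge_0 z); split; nra); nra. }
  replace (1 + z * (g z * (RtoC c * lambda * z / (1 - lambda * (z * z)))) / g z)%C
    with (1 + RtoC c * (lambda * (z * z)) / (1 - lambda * (z * z)))%C by (field; auto).
  revert N hu; generalize (lambda * (z * z))%C; intros u N hu.
  rewrite Cmod2_alt in hu; destruct u as [p q].
  unfold Cdiv, Cinv, Cplus, Cminus, Cplus, Copp, Cmult, RtoC, Re, Im in *; simpl in *.
  set (S := (1 + - p) * ((1 + - p) * 1) + (0 + - q) * ((0 + - q) * 1)).
  assert (hS : 0 < S) by (unfold S; nra).
  (* With u = lambda z^2, this is Re (1 + c u / (1 - u)) - (1 - c / 2) = c (1 - |u|^2) / (2 |1 -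
     u|^2), where [S] is |1 - u|^2. *)
  match goal with |- ?a > ?b => enough (E : a - b = c * (1 - (p * p + q * q)) / (2 * S)) end.
  + apply Rminus_gt; rewrite E; apply Rdiv_lt_0_compat; [apply Rmult_lt_0_compat; lra|lra].
  + unfold S in *; field; lra.
- rewrite C_derive2_f_ext by apply in_disk_0; unfold dg; field.
Qed.

Lemma ext_density_real z x : (lambda * (z * z))%C = RtoC (1 - x) -> 0 < x ->
  g z = RtoC (1 / Rpower x (c / 2)).
Proof.
intros E hx; unfold g; rewrite E.
replace (1 - RtoC (1 - x))%C with (RtoC x) by (rewrite RtoC_minus; ring).
rewrite Cpower_RtoC by assumption; symmetry; apply RtoC_div.
unfold Rpower; generalize (exp_pos (c / 2 * ln x)); lra.
Qed.

(** If lambda z^2 is real, the density is real and positive on the segment from 0 to z, so the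
    integral has the constant direction z / |z| and its modulus is the real integral. *)
Lemma f_ext_extremal z sigma : in_disk z -> -1 <= sigma <= 1 ->
  (lambda * (z * z))%C = RtoC (sigma * Cmod z ^ 2) ->
  Cmod (C_derive (f_ext c lambda) z) = 1 / Rpower (1 - sigma * Cmod z ^ 2) (c / 2) /\
  Cmod (f_ext c lambda z) = RInt (fun t => 1 / Rpower (1 - sigma * t ^ 2) (c / 2)) 0 (Cmod z).
Proof.
intros hz hs E; set (r := Cmod z) in *; unfold in_disk in hz; fold r in hz.
assert (hr := Cmod_ge_0 z : 0 <= r).
assert (base : forall t, -1 < t < 1 -> 0 < 1 - sigma * t ^ 2).
{ intros t ht; assert (0 <= t ^ 2 < 1) by (split; nra); nra. }
assert (hinv : forall x, 0 < 1 / Rpower x (c / 2)).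
{ intros x; apply Rdiv_lt_0_compat; [lra|apply exp_pos]. }
split.
{ rewrite C_derive_f_ext by exact hz.
  rewrite (ext_density_real z (1 - sigma * r ^ 2)).
  - rewrite Cmod_R, Rabs_right; [reflexivity|left; apply hinv].
  - rewrite E; f_equal; ring.
  - apply base; lra. }
set (H := fun t => 1 / Rpower (1 - sigma * t ^ 2) (c / 2)).
assert (cH : forall t, -1 < t < 1 -> continuous H t).
{ intros t ht; specialize (base t ht); apply (ex_derive_continuous (V:=R_NormedModule)).
  unfold H, Rpower; auto_derive; repeat split; [simpl in base; lra|].
  match goal with |- exp ?x <> 0 => generalize (exp_pos x) end; lra. }
destruct (excluded_middle_informative (z = RtoC 0)) as [Ez|Ez].
{ assert (r0 : r = 0) by (unfold r; rewrite Ez; apply Cmod_0).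
  rewrite Ez, f_ext_at_0, r0, Cmod_0; symmetry; apply (RInt_point (V:=R_CompleteNormedModule)). }
assert (hr0 : 0 < r) by now apply Cmod_gt_0.
assert (hrC : RtoC r <> RtoC 0) by (intros K; apply RtoC_inj in K; lra).
assert (EF : f_ext c lambda z = (RtoC (RInt H 0 r) * (z / RtoC r))%C).
{ change (f_ext c lambda z) with (RIntC (fun t => g (RtoC t * z) * z)%C 0 1).
  rewrite (RIntC_ext _ (fun t => RtoC (r * H (t * r)%R) * (z / RtoC r))%C).
  2: lra.
  2:{ intros t ht; rewrite (ext_density_real _ (1 - sigma * (t * r) ^ 2)).
      - unfold H; rewrite RtoC_mult; field_C; assumption.
      - replace (lambda * (RtoC t * z * (RtoC t * z)))%C
          with (RtoC t * RtoC t * (lambda * (z * z)))%C by ring.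
        rewrite E, <- !RtoC_mult; f_equal; ring.
      - apply base; nra. }
  assert (DF : forall t, 0 <= t <= 1 -> is_derive (fun t => RInt H 0 (t * r)) t (r * H (t * r))).
  { intros t ht; apply (is_derive_comp (fun x => RInt H 0 x) (fun t => t * r)).
    - apply (is_derive_RInt_open_unit H cH); nra.
    - auto_derive; auto; ring. }
  rewrite (RIntC_derive (fun t => RtoC (RInt H 0 (t * r)%R) * (z / RtoC r))%C).
  - rewrite Rmult_0_l, Rmult_1_l, RInt_point; change (@zero R_CompleteNormedModule) with 0; ring_C.
  - lra.
  - intros t ht.
    refine (is_Pderive_eq _ _ _ _ (is_derive_ext (V:=C_R_NormedModule) _ _ t _ _ (is_Pderive_comp
      (fun w => 0 + z / RtoC r * w)%C (fun t => RtoC (RInt H 0 (t * r))) t _ _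
      (is_Cderive_affine 0 (z / RtoC r) _) (is_Pderive_RtoC _ t _ (DF t ht)))) _).
    + intros u; simpl; ring_C.
    + ring_C.
  - intros t ht; apply continuous_Cmult; [|apply continuous_const].
    apply (continuous_comp (U:=R_UniformSpace) (V:=R_UniformSpace) (fun t => r * H (t * r)) RtoC);
      [|apply continuous_RtoC].
    apply (continuous_scal_r r (fun t => H (t * r))).
    apply (continuous_comp (fun t => t * r) H).
    + apply (ex_derive_continuous (V:=R_NormedModule)); auto_derive; auto.
    + apply cH; nra. }
rewrite EF, Cmod_mult, Cmod_div, !Cmod_R by assumption; fold r.
rewrite (Rabs_right r) by lra; rewrite Rabs_right; [field; lra|].
apply Rle_ge, RInt_ge_0; [lra| |].
- apply (ex_RInt_continuous (V:=R_CompleteNormedModule)); intros t.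
  rewrite Rmin_left, Rmax_right by lra; intros ht; apply cH; lra.
- intros t _; left; apply hinv.
Qed.
End Extremal.

Lemma exists_rotation (z : C) sigma : Rabs sigma = 1 ->
  exists lambda, Cmod lambda = 1 /\ (lambda * (z * z))%C = RtoC (sigma * Cmod z ^ 2).
Proof.
intros hs; destruct (excluded_middle_informative (z = RtoC 0)) as [->|hz].
- exists (RtoC 1); rewrite Cmod_0, Cmod_1; split; [reflexivity|].
  rewrite pow_i, Rmult_0_r by lia; ring.
- assert (hr : 0 < Cmod z) by now apply Cmod_gt_0.
  exists (RtoC sigma * (Cconj z / z))%C; split.
  + rewrite Cmod_mult, Cmod_R, hs, Cmod_div, Cmod_conj by assumption; field; lra.
  + rewrite RtoC_mult, Cmod2_conj; field; assumption.
Qed.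

Theorem theorem2p2 (c : R) (hc : 0 < c <= 3) :
  (forall f : C -> C, class_F0 c f ->
     forall z : C, in_disk z ->
       (1 / Rpower (1 + Cmod z ^ 2) (c / 2) <= Cmod (C_derive f z)
          <= 1 / Rpower (1 - Cmod z ^ 2) (c / 2)) /\
       (RInt (fun t : R => 1 / Rpower (1 + t ^ 2) (c / 2)) 0 (Cmod z) <= Cmod (f z)
          <= RInt (fun t : R => 1 / Rpower (1 - t ^ 2) (c / 2)) 0 (Cmod z))) /\
  (forall z : C, in_disk z ->
     (exists lambda : C, Cmod lambda = 1 /\ class_F0 c (f_ext c lambda) /\
        1 / Rpower (1 + Cmod z ^ 2) (c / 2) = Cmod (C_derive (f_ext c lambda) z)) /\
     (exists lambda : C, Cmod lambda = 1 /\ class_F0 c (f_ext c lambda) /\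
        Cmod (C_derive (f_ext c lambda) z) = 1 / Rpower (1 - Cmod z ^ 2) (c / 2)) /\
     (exists lambda : C, Cmod lambda = 1 /\ class_F0 c (f_ext c lambda) /\
        RInt (fun t : R => 1 / Rpower (1 + t ^ 2) (c / 2)) 0 (Cmod z)
          = Cmod (f_ext c lambda z)) /\
     (exists lambda : C, Cmod lambda = 1 /\ class_F0 c (f_ext c lambda) /\
        Cmod (f_ext c lambda z)
          = RInt (fun t : R => 1 / Rpower (1 - t ^ 2) (c / 2)) 0 (Cmod z))).
Proof.
split.
- intros f Hf z hz; split; [now apply F0_distortion|].
  split; [now apply F0_growth_lower|now apply F0_growth_upper].
- intros z hz; assert (hc0 : 0 < c) by lra.
  (* The sign - 1 serves both lower bounds at [z], the sign 1 both upper bounds. *)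
  destruct (exists_rotation z (-1)) as [l1 [h1 E1]]; [rewrite Rabs_left; lra|].
  destruct (exists_rotation z 1) as [l2 [h2 E2]]; [apply Rabs_R1|].
  destruct (f_ext_extremal c l1 h1 z (-1) hz ltac:(lra) E1) as [A1 B1].
  destruct (f_ext_extremal c l2 h2 z 1 hz ltac:(lra) E2) as [A2 B2].
  assert (P1 : forall x, 1 - -1 * x = 1 + x) by (intros; ring).
  assert (P2 : forall x, 1 - 1 * x = 1 - x) by (intros; ring).
  rewrite P1 in A1; rewrite P2 in A2.
  rewrite (RInt_ext _ (fun t => 1 / Rpower (1 + t ^ 2) (c / 2))) in B1
    by (intros; now rewrite P1).
  rewrite (RInt_ext _ (fun t => 1 / Rpower (1 - t ^ 2) (c / 2))) in B2
    by (intros; now rewrite P2).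
  assert (F1 := class_F0_f_ext c l1 hc0 h1); assert (F2 := class_F0_f_ext c l2 hc0 h2).
  split; [|split; [|split]]; [exists l1|exists l2|exists l1|exists l2]; auto.
Qed.
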